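(* Let $n,\ell,m$ be integers with $1<\ell<m\le\lfloor\frac{n-1}{2}\rfloor$. Then $\mathrm{K}(n;\ell,m)$ is a $((3n)_4)$ configuration except in the following cases, in which it is not: \begin{itemize} \item $\mathrm{K}(6k;2k,3k-1)$, $\mathrm{K}(6k;3k-2,3k-1)$ and $\mathrm{K}(6k;2k,3k-2)$ for integers $k\ge 2$; \item $\mathrm{K}(12k+6;3k+1,4k+2)$, $\mathrm{K}(12k+6;3k+2,4k+2)$ and $\mathrm{K}(12k+6;3k+1,3k+2)$ for integers $k\ge 1$; \item $\mathrm{K}(30;4,6)$, $\mathrm{K}(30;4,7)$ and $\mathrm{K}(30;6,7)$; \item $\mathrm{K}(30;6,10)$, $\mathrm{K}(30;6,11)$ and $\mathrm{K}(30;10,11)$; \item $\mathrm{K}(30;8,12)$, $\mathrm{K}(30;8,13)$ and $\mathrm{K}(30;12,13)$; \item $\mathrm{K}(42;6,12)$, $\mathrm{K}(42;6,13)$ and $\mathrm{K}(42;12,13)$. \end{itemize}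
   Context: All regular $n$-gons are convex and lie in the Euclidean plane; indices of vertices are taken modulo $n$. For a regular $n$-gon $\mathcal{R}=R_0R_1\dots R_{n-1}$ (vertices in cyclic order) and $1\le k\le\lfloor\frac{n-1}{2}\rfloor$, the $k$-th diagonals of $\mathcal{R}$ are the $n$ lines $R_jR_{j+k}$, $j=0,\dots,n-1$ (the $1$-st diagonals are the side lines). The $k$-th $n$-gon of $\mathcal{R}$ is the regular $n$-gon $T_0T_1\dots T_{n-1}$ with consecutive vertices $T_j=R_{j-1}R_{j-1+k}\cap R_jR_{j+k}$ for $k\geq 2$ (for $k=1$ it is $\mathcal{R}$ itself, $T_j=R_j$). Let $\mathcal{A}_1=A_0A_1\dots A_{n-1}$ be a regular $n$-gon and let $\mathcal{A}_k$ denote the $k$-th $n$-gon of $\mathcal{A}_1$. By a theorem of Kárteszi, the set of $m$-th diagonals of $\mathcal{A}_\ell$ coincides, as a set of lines, with the set of $\ell$-th diagonals of $\mathcal{A}_m$. $\mathrm{K}(n;\ell,m)$ is the point-line structure in the plane whose points are the vertices of $\mathcal{A}_1$, $\mathcal{A}_\ell$ and $\mathcal{A}_m$, and whose lines are the $\ell$-th diagonals of $\mathcal{A}_1$, the $m$-th diagonals of $\mathcal{A}_1$, and the common lines of the $\ell$-th diagonals of $\mathcal{A}_m$ and the $m$-th diagonals of $\mathcal{A}_\ell$; incidence is the geometric incidence in the plane. A $((3n)_4)$ configuration is a structure consisting of $3n$ distinct points and $3n$ distinct lines such that every point is incident with exactly $4$ of the lines and every line is incident with exactly $4$ of the points. 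*)

(* Defs.v *)
From HB Require Import structures.
From mathcomp Require Import all_boot all_order all_algebra.
From mathcomp Require Import all_classical all_reals all_analysis.

Set Implicit Arguments.
Unset Strict Implicit.
Unset Printing Implicit Defensive.

Import Order.TTheory GRing.Theory Num.Theory.
Local Open Scope classical_set_scope.
Local Open Scope card_scope.
Local Open Scope ring_scope.

Definition line (R : realType) (P Q : R * R) : set (R * R) :=
  [set P + t *: (Q - P) | t in [set: R]].

(* A polygon is a vertex family indexed by all integers. In a regular n-gon
   the n vertices are equally spaced on a circle, in cyclic order, so that the
   family is n-periodic: this is how vertex indices are read modulo n.
   The boolean s tells in which direction the circle is traversed. *)
Definition regular_ngon (R : realType) (n : nat) (A : int -> R * R) : Prop :=
  (2 < n)%N /\
  exists (c : R * R) (r theta : R) (s : bool),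
    0 < r /\
    forall j : int,
      let phi := theta + (-1) ^+ s * (2 * pi * j%:~R / n%:R) in
      A j = (c.1 + r * cos phi, c.2 + r * sin phi).

Definition diagonals (R : realType) (k : nat) (A : int -> R * R) :
    set (set (R * R)) :=
  range (fun j : int => line (A j) (A (j + k%:Z))).

(* [xget 0] picks an element of a nonempty set. For 1 < k <= (n - 1) / 2 and A a regular
   n-gon, the two lines are not parallel, so they meet in exactly one point. *)
Definition kth_ngon (R : realType) (k : nat) (A : int -> R * R) :
    int -> R * R :=
  fun j => if k == 1%N then A j
           else xget 0 (line (A (j - 1)) (A (j - 1 + k%:Z)) `&`
                        line (A j) (A (j + k%:Z))).

Definition K_points (R : realType) (l m : nat) (A : int -> R * R) :
    set (R * R) :=
  range A `|` range (kth_ngon l A) `|` range (kth_ngon m A).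

Definition K_lines (R : realType) (l m : nat) (A : int -> R * R) :
    set (set (R * R)) :=
  diagonals l A `|` diagonals m A `|`
  (diagonals l (kth_ngon m A) `&` diagonals m (kth_ngon l A)).

(* A (N_d) configuration in the plane. Points and lines are given as sets, so
   the cardinality conditions count distinct points and distinct lines. *)
Definition configuration (R : realType) (N d : nat)
    (P : set (R * R)) (L : set (set (R * R))) : Prop :=
  [/\ P #= `I_N,
      L #= `I_N,
      forall p, P p -> [set x | L x /\ x p] #= `I_d
    & forall x, L x -> [set p | P p /\ x p] #= `I_d].

Definition exceptional (n l m : nat) : Prop :=
  [\/ exists2 k : nat, (2 <= k)%N &
        (n, l, m) \in [:: (6 * k, 2 * k, 3 * k - 1);
                          (6 * k, 3 * k - 2, 3 * k - 1);
                          (6 * k, 2 * k, 3 * k - 2)]%N,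
      exists2 k : nat, (1 <= k)%N &
        (n, l, m) \in [:: (12 * k + 6, 3 * k + 1, 4 * k + 2);
                          (12 * k + 6, 3 * k + 2, 4 * k + 2);
                          (12 * k + 6, 3 * k + 1, 3 * k + 2)]%N,
      (n, l, m) \in [:: (30, 4, 6); (30, 4, 7); (30, 6, 7);
                        (30, 6, 10); (30, 6, 11); (30, 10, 11);
                        (30, 8, 12); (30, 8, 13); (30, 12, 13)]%N
    | (n, l, m) \in [:: (42, 6, 12); (42, 6, 13); (42, 12, 13)]%N].

(* Main.v *)
Require Import Defs.
From mathcomp Require Import all_boot all_order all_algebra.
From mathcomp Require Import algC cyclotomic complex.
From mathcomp Require Import all_classical all_reals all_analysis.
From mathcomp Require Import ring lra zify.

(** Put c u = cos (u pi / n), and let A be a regular n-gon of circumradius r.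
    The vertices of the k-th n-gon lie at distance (r / c 1) c k from the
    centre, in the directions u pi / n with u of the parity of k - 1; the
    b-th diagonals of the a-th n-gon are the lines at distance
    (r / c 1) c a c b from the centre whose normals have the directions
    v pi / n with v of the parity of a + b - 1, a description symmetric in a
    and b.  Hence the points of K(n; l, m) form three classes indexed by
    k = 1, l, m, its lines form three classes indexed by the pairs {a, b} of
    these numbers, and a vertex of class k in direction u is on a line of
    class {a, b} with normal direction v iff c k c (u - v) = c a c b.  If
    k = a this means u - v = b or - b modulo 2 n.  So there are 3 n points and
    3 n lines, each line of class {a, b} contains two vertices of class a and
    two of class b, and the structure is a configuration iff there is no
    incidence with the third class, that is iff

      c k c s <> c a c b   whenever {k, a, b} = {1, l, m} and 1 + l + m + s
                           is even.

    As each such equation involves c 1, everything comes down to solving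

      c 1 c x = c y c w,   0 <= x, y, w < n / 2,  x + y + w odd.

    With z = exp (i pi / n) this says that the eight terms z^u1, z^-u1, z^u2,
    z^-u2, - z^u3, - z^-u3, - z^u4, - z^-u4 sum to 0, where u1 = y + w,
    u2 = y - w, u3 = x + 1 and u4 = x - 1.  Since z is a primitive root of
    unity of order N = 2 n, the relation survives when z is replaced by any
    other root of the N-th cyclotomic polynomial, in characteristic zero or
    not ([expsum_prim]).  If d divides N and every 1 + j N / d is prime to N,
    averaging over these conjugates shows that, for each residue r modulo d,
    the terms whose exponent is congruent to r already sum to 0
    ([class_sum_eq0]).  As u3 and u4 differ by 2, for d not dividing 4 such
    short sums can be solved by hand: either {y, w} = {1, x}, or c u3 = 0 or
    c u1 = 0, which yields two one-parameter families
    ([split_classification]).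

    This applies with d = 8 if 8 divides n, and with d = p if p is an odd
    prime such that p^2 divides n.  It also applies with d = p if p >= 11 is a
    prime divisor of n: at p || n all class sums are equal up to roots of
    unity, and eight terms cannot meet all the residues.  For p = 7 either a
    residue is missed again, or the residues of the u_i are distinct up to
    sign and n divides 42.  In the remaining cases n divides 60
    ([classify_up_to_60]).  For the divisors of 42 and 60 the relation is
    tested at roots of unity in the fields with 337 and 241 elements, which
    contain them; this leaves the two families and the sporadic solutions at
    n = 30 and n = 42.  Conversely each exceptional triple does come from a
    solution, by the vanishing of sums of cosines of equally spaced angles
    ([exceptional_relation]). *)
Set Implicit Arguments.
Unset Strict Implicit.
Unset Printing Implicit Defensive.
Import Order.TTheory GRing.Theory Num.Theory.
Local Open Scope ring_scope.

(** * Galois invariance of integer relations between roots of unity *)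

Lemma root_Cyclotomic_prim (F : idomainType) (N : nat) (z : F) :
  N.-primitive_root z -> root (map_poly intr 'Phi_N) z.
Proof.
move=> prim_z; have N_gt0 := prim_order_gt0 prim_z.
have XN d : (0 < d)%N ->
  (\prod_(e <- divisors d) map_poly intr 'Phi_e).[z] = z ^+ d - 1.
  move=> d0; rewrite -rmorph_prod prod_Cyclotomic // rmorphB rmorph1 rmorphXn
    /=.
  by rewrite map_polyX !hornerE.
have: root (\prod_(d <- divisors N) map_poly intr 'Phi_d) z.
  by rewrite rootE XN // (prim_expr_order prim_z) subrr.
rewrite rootE horner_prod prodf_seq_eq0 => /hasP[d].
rewrite -dvdn_divisors // => dN /= rd.
suff /eqP <- : d == N by [].
have d_gt0 := dvdn_gt0 N_gt0 dN.
rewrite eqn_dvd dN (prim_order_dvd prim_z) -subr_eq0 -XN //=.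
rewrite horner_prod (big_rem d) /=; last by rewrite -dvdn_divisors.
by rewrite (rootP rd) mul0r.
Qed.

(** The cyclotomic polynomial is irreducible over the rationals, because it is
    the minimal polynomial of the primitive roots among the algebraic numbers;
    so a polynomial sharing one root with it in any field of characteristic
    zero is a multiple of it, and over the integers since it is monic. *)
Lemma Cyclotomic_dvd (F : numFieldType) (N : nat) (z : F) (P : {poly int}) :
  N.-primitive_root z -> root (map_poly intr P) z -> exists Q, P = 'Phi_N * Q.
Proof.
move=> prim_z rPz; have N_gt0 := prim_order_gt0 prim_z.
have [w prim_w] := C_prim_root_exists N_gt0.
have map_ratr (K : numFieldType) (p : {poly int}) :
  map_poly ratr (map_poly intr p : {poly rat}) = map_poly intr p :> {poly K}.
  by rewrite -map_poly_comp; apply: eq_map_poly => i /=; rewrite ratr_int.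
have [p [Dp _] minp] := minCpolyP w.
have Dphi : p = map_poly intr 'Phi_N :> {poly rat}.
  apply: (map_poly_inj (ratr : {rmorphism rat -> algC})).
  by rewrite -Dp (minCpoly_cyclotomic prim_w) -(Cintr_Cyclotomic prim_w)
    map_ratr.
suff: (map_poly intr 'Phi_N : {poly rat}) %| map_poly intr P.
  rewrite dvdp_rat_int => /dvdpP_int[Q ->]; exists Q.
  by rewrite zprimitive_monic ?Cyclotomic_monic.
rewrite -Dphi; set Pr : {poly rat} := map_poly intr P.
have p0 : p != 0.
  by rewrite Dphi -size_poly_eq0 size_map_poly_id0 ?size_Cyclotomic //
    (monicP (Cyclotomic_monic N)) intr_eq0.
have [h Dh] : exists h, p = h * gcdp p Pr by apply/dvdpP/dvdp_gcdl.
have: root (map_poly ratr p) w by rewrite minp dvdpp.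
rewrite {1}Dh rmorphM rootM !minp => /orP[ph|]; last first.
  by rewrite dvdp_gcd => /andP[].
have h0 : h != 0 by apply: contraNneq p0 => h0; rewrite Dh h0 mul0r.
have g0 : gcdp p Pr != 0 by apply: contraNneq p0 => g0; rewrite Dh g0 mulr0.
have := dvdp_leq h0 ph.
rewrite {1}Dh size_mul // -subn1 leq_subLR [(1 + _)%N]addnC leq_add2l => sz.
have : coprimep p Pr.
  rewrite /coprimep eqn_leq size_poly_gt0 g0 andbT.
  exact: sz.
move/Bezout_coprimepP => [[u v] /= /eqpP[[a b] /= /andP[a0 b0] eab]].
have := congr1 (fun q => (map_poly ratr q : {poly F}).[z]) eab.
rewrite /= !linearZ /= !rmorphD !rmorphM /= rmorph1 !hornerE.
rewrite Dphi !map_ratr (rootP rPz) (rootP (root_Cyclotomic_prim prim_z)).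
rewrite !mulr0 addr0 mulr0 => /esym/eqP.
by rewrite ?mulr1 fmorph_eq0 (negPf b0).
Qed.

(** An integer relation satisfied by one primitive root of unity holds for
    every other one of the same order, also in positive characteristic. *)
Lemma root_of_prim_root (F : numFieldType) (K : idomainType) (N : nat)
    (z : F) (w : K) (P : {poly int}) :
  N.-primitive_root z -> N.-primitive_root w ->
  root (map_poly intr P) z -> root (map_poly intr P) w.
Proof.
move=> prim_z prim_w /(Cyclotomic_dvd prim_z)[Q ->].
by rewrite rmorphM rootM root_Cyclotomic_prim.
Qed.

(** * Exponential sums and their class sums *)

Lemma dvdz_small (m : nat) (e : int) :
  (m %| e)%Z -> - m%:Z < e < m%:Z -> e = 0.
Proof.
rewrite dvdzE /= => me lt_em; apply/eqP; rewrite -absz_eq0.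
by case: (posnP `|e|) me => [-> //|e0 /(dvdn_leq e0)]; lia.
Qed.

(** The sum of the terms c z^a over the pairs (c, a) of the list V. *)
Definition expsum (F : fieldType) (V : seq (int * int)) (z : F) : F :=
  \sum_(t <- V) t.1%:~R * z ^ t.2.

(** The part of [expsum V z] whose exponents are congruent to r modulo d. *)
Definition class_sum (F : fieldType) (V : seq (int * int)) (z : F)
    (d : nat) (r : int) : F :=
  \sum_(t <- V | (d %| t.2 - r)%Z) t.1%:~R * z ^ t.2.

Lemma prim_root_neq0 (F : fieldType) N (z : F) : N.-primitive_root z -> z != 0.
Proof.
move=> pz; apply/eqP => z0; have := prim_expr_order pz.
have := prim_order_gt0 pz; case: N pz => // N _ _.
by rewrite z0 exprS mul0r => /esym/eqP; rewrite oner_eq0.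
Qed.

Lemma prim_exprz_eq1 (F : fieldType) N (z : F) (a : int) :
  N.-primitive_root z -> (z ^ a == 1) = (N %| a)%Z.
Proof.
move=> pz; case: a => a.
  by rewrite -exprnP -(prim_order_dvd pz).
by rewrite NegzE -invr_expz invr_eq1 dvdzE abszN -exprnP -(prim_order_dvd pz).
Qed.

Lemma expsum_prim (F : numFieldType) (K : fieldType) N (z : F) (w : K) V :
  N.-primitive_root z -> N.-primitive_root w -> expsum V z = 0 ->
  expsum V w = 0.
Proof.
move=> pz pw; have N_gt0 := prim_order_gt0 pz.
pose P : {poly int} := \sum_(t <- V) t.1%:P * 'X^(absz (t.2 %% N)%Z).
have PE (L : fieldType) (v : L) : N.-primitive_root v ->
    (map_poly intr P).[v] = expsum V v.
  move=> pv; rewrite rmorph_sum horner_sum; apply: eq_bigr => -[c a] _ /=.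
  rewrite rmorphM rmorphXn /= map_polyC map_polyX !hornerE /=; congr (_ * _).
  have aN : 0 <= (a %% N)%Z by rewrite modz_ge0 // -lt0n.
  rewrite exprnP (gez0_abs aN).
  rewrite [in RHS](divz_eq a N) [RHS]expfzDr ?(prim_root_neq0 pv) //.
  suff /eqP -> : v ^ ((a %/ N)%Z * N) == 1 by rewrite mul1r.
  by rewrite (prim_exprz_eq1 _ pv) dvdz_mull.
rewrite -!PE // => /rootP rz.
exact/rootP/(root_of_prim_root pz pw).
Qed.

Lemma sum_prim_powers (F : fieldType) d (o : F) (a : int) :
  d.-primitive_root o ->
  \sum_(j < d) o ^ (a * j%:Z) = if (d %| a)%Z then d%:R else 0.
Proof.
move=> po; have [da|nda] := boolP (d %| a)%Z.
  rewrite (eq_bigr (fun=> 1)) => [|j _]; first by rewrite sumr_const card_ord.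
  by apply/eqP; rewrite (prim_exprz_eq1 _ po) dvdz_mulr.
have : (o ^ a) ^+ d - 1 = 0.
  apply/eqP; rewrite subr_eq0 exprnP exprz_exp.
  by rewrite (prim_exprz_eq1 _ po) dvdz_mull.
rewrite subrX1 => /eqP; rewrite mulf_eq0 subr_eq0 (prim_exprz_eq1 _ po).
rewrite (negPf nda) /= => /eqP S0; rewrite -[RHS]S0.
by apply: eq_bigr => j _; rewrite exprnP exprz_exp.
Qed.

(** Discrete Fourier inversion: multiplying z by the j-th power of the d-th
    root of unity z^(N/d) amounts to raising z to the power 1 + j N / d. *)
Lemma class_sumE (F : fieldType) N d (z : F) V (r : int) :
  N.-primitive_root z -> (d %| N)%N ->
  d%:R * class_sum V z d r =
  \sum_(j < d) (z ^+ (N %/ d)) ^ (- (r * j%:Z)) *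
               expsum V (z ^+ (1 + j * (N %/ d))).
Proof.
move=> pz dN; have z0 := prim_root_neq0 pz.
have po := dvdn_prim_root pz dN.
rewrite /expsum; under eq_bigr do rewrite big_distrr /=.
rewrite exchange_big /= /class_sum big_mkcond /= big_distrr /=.
apply: eq_bigr => -[c a] _ /=.
transitivity (\sum_(j < d) (z ^+ (N %/ d)) ^ ((a - r) * j%:Z) *
  (c%:~R * z ^ a)).
  by rewrite -big_distrl /= (sum_prim_powers _ po); case: ifP => _;
    rewrite ?mulr0 ?mul0r.
apply: eq_bigr => j _; rewrite mulrCA; rewrite [RHS]mulrCA; congr (_ * _).
rewrite !exprnP !exprz_exp -!expfzDr //; congr (z ^ _).
by rewrite PoszD PoszM; ring.
Qed.

Lemma class_sum_eq0 (F : numFieldType) N d (z : F) V (r : int) :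
  N.-primitive_root z -> (0 < d)%N -> (d %| N)%N ->
  (forall j, coprime (1 + j * (N %/ d)) N) ->
  expsum V z = 0 -> class_sum V z d r = 0.
Proof.
move=> pz d0 dN co V0; apply/eqP.
have: d%:R * class_sum V z d r == 0.
  rewrite (class_sumE _ _ pz dN) big1 // => j _.
  by rewrite (expsum_prim pz) ?mulr0 // prim_root_exp_coprime.
by rewrite mulf_eq0 pnatr_eq0 eqn0Ngt d0.
Qed.

(** For a prime p at most one of the exponents 1 + j N / p with j < p fails to
    be prime to N, so at most one term survives in [class_sumE]. *)
Lemma class_sum_prime (F : numFieldType) N p (z : F) V :
  N.-primitive_root z -> prime p -> (p %| N)%N -> expsum V z = 0 ->
  exists j0 : nat, forall r : int,
    class_sum V z p r * (z ^+ (N %/ p)) ^ (r * j0%:Z) = class_sum V z p 0.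
Proof.
move=> pz pp pN V0; set m := (N %/ p)%N.
have N0 := prim_order_gt0 pz.
have DN : N = (m * p)%N by rewrite divnK.
have m0 : (0 < m)%N by rewrite lt0n; apply: contraTneq N0; rewrite DN => ->.
have co j : ~~ (p %| 1 + j * m)%N -> coprime (1 + j * m) N.
  move=> npj; rewrite DN coprimeMr [coprime _ p]coprime_sym (prime_coprime _ pp)
    npj.
  by rewrite coprime_sym /coprime addnC gcdnMDl gcdn1.
have [j0 Hj0] : exists j0 : 'I_p, forall j : 'I_p, j != j0 ->
    coprime (1 + j * m) N.
  have [/existsP[j0 nco]|] := boolP [exists j : 'I_p, (p %| 1 + j * m)%N];
    last first.
    move=> /existsPn H; exists (Ordinal (prime_gt0 pp)) => j _; exact/co/H.
  exists j0 => j jj0; apply: co; apply: contraNN jj0 => nj.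
  have nm : ~~ (p %| m)%N.
    apply/negP => pm; move: nco; rewrite dvdn_addl ?dvdn_mull //.
    by rewrite dvdn1; case: (p) pp => [|[]].
  have : (p %| j%:Z - j0%:Z)%Z.
    have : (p %| (j%:Z - j0%:Z) * m%:Z)%Z.
      have -> : (j%:Z - j0%:Z) * m%:Z = (1 + j * m)%N%:Z - (1 + j0 * m)%N%:Z.
        by rewrite !PoszD !PoszM; ring.
      by rewrite rpredB.
    by rewrite Gauss_dvdzl // coprimezE /= prime_coprime.
  have := ltn_ord j; have := ltn_ord j0; rewrite -val_eqE /=.
  by move=> h1 h2 /dvdz_small e; apply/eqP; lia.
exists j0 => r.
have p0 : p%:R != 0 :> F by rewrite pnatr_eq0 -lt0n prime_gt0.
apply: (mulfI p0); rewrite mulrA !(class_sumE _ _ pz pN) -/m.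
rewrite (bigD1 j0) //= [in RHS](bigD1 j0) //= !big1 ?addr0.
- have om0 : z ^+ m != 0 by rewrite expf_neq0 // (prim_root_neq0 pz).
  rewrite mul0r oppr0 expr0z mul1r mulrAC -expfzDr // addNr expr0z.
  by rewrite mul1r.
- by move=> j jj0; rewrite (expsum_prim pz) ?mulr0 // prim_root_exp_coprime //
  Hj0.
- by move=> j jj0; rewrite (expsum_prim pz) ?mulr0 // prim_root_exp_coprime //
  Hj0.
Qed.

(** * Vanishing class sums force the trivial or a parametric solution *)

(** The terms of cos u1 + cos u2 - cos u3 - cos u4, up to a factor 2. *)
Definition cos_terms (u1 u2 u3 u4 : int) : seq (int * int) :=
  [:: (1, u1); (1, - u1); (1, u2); (1, - u2);
      (-1, u3); (-1, - u3); (-1, u4); (-1, - u4)].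

Lemma dvdz_opp (m a : int) : (m %| - a)%Z = (m %| a)%Z.
Proof. by rewrite !dvdzE abszN. Qed.

(** The arithmetic of the case c u3 = 0, where z^v1 + z^v2 = z^u4 for some v1,
    v2 equal to u1, u2 up to sign. *)
Lemma third_half_triple (n x y w : nat) (v1 v2 : int) :
  (4 < n)%N -> (2 * y < n)%N -> (2 * w < n)%N -> (2 * x + 2 = n)%N ->
  v1 = y%:Z + w%:Z \/ v1 = - (y%:Z + w%:Z) ->
  v2 = y%:Z - w%:Z \/ v2 = - (y%:Z - w%:Z) ->
  (2 * n %| v1 + v2 - (x%:Z - 1 + (x%:Z - 1)))%Z ->
  (2 * n %| 3 * (v1 - (x%:Z - 1)) - n%:Z)%Z ->
  exists k, [/\ n = 6 * k, x = 3 * k - 1 &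
       (y = 3 * k - 2 /\ w = 2 * k) \/ (w = 3 * k - 2 /\ y = 2 * k)]%N.
Proof.
move=> n4 hy hw hx Hv1 Hv2 /dvdz_small d12 /dvdz_small d1.
have {}d12 : v1 + v2 = 2 * x%:Z - 2.
  have /d12 : - (2 * n)%N%:Z < v1 + v2 - (x%:Z - 1 + (x%:Z - 1)) < (2 * n)%N by
    lia.
  lia.
have : (v1 = y%:Z + w%:Z /\ (y + 1 = x)%N) \/
  (v1 = y%:Z + w%:Z /\ (w + 1 = x)%N).
  by clear d1; lia.
have step a b : a = y /\ b = w \/ a = w /\ b = y -> v1 = a%:Z + b%:Z ->
    (a + 1 = x)%N -> (3 * b = n)%N.
  move=> hab hv ha.
  have : 3 * (v1 - (x%:Z - 1)) - n%:Z = 0 by apply: d1; lia.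
  lia.
clear d1; case=> [[hv1 e]|[hv1 e]].
  have h := step y w (or_introl (conj erefl erefl)) hv1 e.
  by exists ((x + 1) %/ 3)%N; split; lia.
have h := step w y (or_intror (conj erefl erefl)) (etrans hv1 (addrC _ _)) e.
by exists ((x + 1) %/ 3)%N; split; lia.
Qed.

(** The arithmetic of the case c u1 = 0, where 2 c x = 1. *)
Lemma third_quarter_triple (n x y w : nat) :
  (3 * x = n)%N -> (2 * (y + w) = n)%N -> (y = w + 1)%N \/ (w = y + 1)%N ->
  exists k, [/\ n = 12 * k + 6, x = 4 * k + 2 &
       (y = 3 * k + 1 /\ w = 3 * k + 2) \/ (w = 3 * k + 1 /\ y = 3 * k + 2)]%N.
Proof. by move=> hx hyw hd; exists ((x - 2) %/ 4)%N; split; lia. Qed.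

Section Split.
Variables (F : numFieldType) (n : nat) (z : F).
Hypothesis pz : (2 * n).-primitive_root z.

(* In the names below [cosz] refers to z^a + z^(-a), twice a cosine. *)
Lemma primz_half : z ^ n%:Z = -1.
Proof.
have n0 : (0 < n)%N by have := prim_order_gt0 pz; lia.
have : (z ^ n%:Z) ^+ 2 == 1 by rewrite exprnP exprz_exp (prim_exprz_eq1 _ pz)
  dvdzE abszM /= mulnC.
rewrite sqrf_eq1 => /orP[|/eqP //]; rewrite (prim_exprz_eq1 _ pz) =>
  /dvdz_small.
lia.
Qed.

Lemma primz_eq (a b : int) : z ^ a = z ^ b -> (2 * n %| a - b)%Z.
Proof.
have z0 := prim_root_neq0 pz.
move=> e; rewrite -(prim_exprz_eq1 _ pz) expfzDr // e -expfzDr // subrr.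
by rewrite expr0z.
Qed.

Lemma primz_opp (a b : int) : z ^ a = - z ^ b -> (2 * n %| a - b - n%:Z)%Z.
Proof.
have z0 := prim_root_neq0 pz.
rewrite -mulN1r -primz_half -expfzDr // => /primz_eq.
by rewrite opprD addrA addrAC.
Qed.

Lemma cosz_eq (a b : int) : z ^ a + z ^ (- a) = z ^ b + z ^ (- b) ->
  (2 * n %| a - b)%Z \/ (2 * n %| a + b)%Z.
Proof.
have z0 := prim_root_neq0 pz.
have za : z ^ a != 0 by rewrite expfz_neq0.
have zb : z ^ b != 0 by rewrite expfz_neq0.
rewrite -!invr_expz => e.
have : (z ^ a - z ^ b) * (z ^ a - (z ^ b)^-1) = 0.
  transitivity (z ^ a * (z ^ a + (z ^ a)^-1 - (z ^ b + (z ^ b)^-1))).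
    by field; rewrite za zb.
  by rewrite e subrr mulr0.
move/eqP; rewrite mulf_eq0 !subr_eq0 => /orP[/eqP/primz_eq|]; first by left.
by rewrite invr_expz => /eqP/primz_eq; rewrite opprK; right.
Qed.

Lemma cosz_eq0 (a : int) : z ^ a + z ^ (- a) = 0 -> (2 * n %| 2 * a - n%:Z)%Z.
Proof.
have -> : 2 * a - n%:Z = a - (- a) - n%:Z by lia.
by move/eqP; rewrite addr_eq0 => /eqP/primz_opp.
Qed.

Lemma cosz_eq1 (a : int) : z ^ a + z ^ (- a) = 1 -> (2 * n %| 3 * a - n%:Z)%Z.
Proof.
have z0 := prim_root_neq0 pz.
have za : z ^ a != 0 by rewrite expfz_neq0.
rewrite -invr_expz => e.
rewrite -[3 * a]subr0 -[0]/(0%:Z); apply: primz_opp; rewrite expr0z.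
rewrite mulrC -exprz_exp; apply/eqP; rewrite -addr_eq0 -exprnP.
have -> : (z ^ a) ^+ 3 + 1 =
  (z ^ a + 1) * z ^ a * (z ^ a + (z ^ a)^-1 - 1) by field.
by rewrite e subrr mulr0.
Qed.

(** Two pairs of numbers with the same sum and the same sum of inverses are
    equal, unless the sum is 0.  For complex numbers of modulus 1 the second
    condition is the conjugate of the first one. *)
Lemma two_units_sum (a b c d : F) : a != 0 -> b != 0 -> c != 0 -> d != 0 ->
  a + b = c + d -> a^-1 + b^-1 = c^-1 + d^-1 ->
  [\/ a = c /\ b = d, a = d /\ b = c | a + b = 0].
Proof.
move=> a0 b0 c0 d0 e1 e2.
have [ab0|ab0] := eqVneq (a + b) 0; first by constructor 3.
have e3 : a * b = c * d.
  apply: (mulfI ab0); apply/eqP; rewrite -subr_eq0 {1}e1.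
  have -> : (c + d) * (a * b) - (a + b) * (c * d) =
      (a * b) * (c * d) * ((c^-1 + d^-1) - (a^-1 + b^-1)).
    by field; rewrite a0 b0 c0 d0.
  by rewrite e2 subrr mulr0.
have : (a - c) * (a - d) = 0.
  transitivity (a * (a + b - (c + d)) - (a * b - c * d)); first by ring.
  by rewrite e1 e3 !subrr mulr0 subrr.
move/eqP; rewrite mulf_eq0 !subr_eq0 => /orP[/eqP ac|/eqP ad].
  by constructor 1; split=> //; apply: (addrI a); rewrite e1 ac.
by constructor 2; split=> //; apply: (addrI a); rewrite e1 ad addrC.
Qed.

Lemma class_sum_cos_terms (d : nat) (r u1 u2 u3 u4 : int) :
  let D v := (d %| v - r)%Z in
  class_sum (cos_terms u1 u2 u3 u4) z d r =
    ((if D u1 then z ^ u1 else 0) + (if D (- u1) then z ^ (- u1) else 0)) +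
    ((if D u2 then z ^ u2 else 0) + (if D (- u2) then z ^ (- u2) else 0)) -
    ((if D u3 then z ^ u3 else 0) + (if D (- u3) then z ^ (- u3) else 0)) -
    ((if D u4 then z ^ u4 else 0) + (if D (- u4) then z ^ (- u4) else 0)).
Proof.
move=> D; rewrite /class_sum big_mkcond !big_cons big_nil /=.
rewrite -/(D u1) -/(D (- u1)) -/(D u2) -/(D (- u2)) -/(D u3) -/(D (- u3)).
rewrite -/(D u4) -/(D (- u4)) !(mulr1z, mulrN1z, mul1r, mulN1r).
have nif (b : bool) (a : F) : (if b then - a else 0) = - (if b then a else 0).
  by case: b; rewrite ?oppr0.
by rewrite !nif !opprD !addrA addr0.
Qed.

(** The solutions of c 1 c x = c y c w found by the class sum argument: the
    trivial ones and two one-parameter families. *)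
Definition trivial_or_family (x y w : nat) : Prop :=
  [\/ (y = 1 /\ w = x) \/ (w = 1 /\ y = x),
     exists k, [/\ n = 6 * k, x = 3 * k - 1 &
       (y = 3 * k - 2 /\ w = 2 * k) \/ (w = 3 * k - 2 /\ y = 2 * k)]
   | exists k, [/\ n = 12 * k + 6, x = 4 * k + 2 &
       (y = 3 * k + 1 /\ w = 3 * k + 2) \/ (w = 3 * k + 1 /\ y = 3 * k + 2)]]%N.

(** The terms congruent to u3 are z^u3, possibly z^-u4, and at most one of each
    of z^u1, z^-u1 and z^u2, z^-u2; if u3 = - u3 modulo d one uses u4, whose
    class then contains none of z^u3, z^-u3 and z^-u4. *)
Lemma split_classification (d x y w : nat) :
  (4 < n)%N -> (2 * x < n)%N -> (2 * y < n)%N -> (2 * w < n)%N ->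
  ~~ (d %| 4)%N ->
  let V := cos_terms (y%:Z + w%:Z) (y%:Z - w%:Z) (x%:Z + 1) (x%:Z - 1) in
  expsum V z = 0 -> (forall r, class_sum V z d r = 0) ->
  trivial_or_family x y w.
Proof.
move=> n4 hx hy hw nd4 V; rewrite /V.
set u1 := y%:Z + w%:Z; set u2 := y%:Z - w%:Z; set u3 := x%:Z + 1;
  set u4 := x%:Z - 1.
pose c a := z ^ a + z ^ (- a).
have z0 := prim_root_neq0 pz.
have zn0 a : z ^ a != 0 by rewrite expfz_neq0.
have simpC := (mulr1z, mulrN1z, mul1r, mulN1r).
move=> E0; have E : c u1 + c u2 = c u3 + c u4.
  apply/eqP; rewrite -subr_eq0 -E0 /expsum !big_cons big_nil /= !simpC /c.
  by apply/eqP; ring.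
move=> S0.
have cN a : c (- a) = c a by rewrite /c opprK addrC.
(* An equal pair of cosines leaves another equal pair: the trivial solutions. *)
have T13 : c u1 = c u3 -> trivial_or_family x y w.
  move=> e13; have /cosz_eq e24 : c u2 = c u4 by apply: (addrI (c u1));
    rewrite E e13.
  constructor 1; case: (cosz_eq e13) => /dvdz_small; case: e24 => /dvdz_small;
    lia.
have T14 : c u1 = c u4 -> trivial_or_family x y w.
  move=> e14; have /cosz_eq e23 : c u2 = c u3.
    by apply: (addrI (c u1)); rewrite E e14 addrC.
  constructor 1; case: (cosz_eq e14) => /dvdz_small; case: e23 => /dvdz_small;
    lia.
have T24 : c u2 = c u4 -> trivial_or_family x y w.
  by move=> e; apply: T13; apply: (addIr (c u2)); rewrite E e.
have T23 : c u2 = c u3 -> trivial_or_family x y w.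
  by move=> e; apply: T14; apply: (addIr (c u2)); rewrite E e addrC.
(* The next two quantities do not vanish because x < n / 2. *)
have no4 : c u4 != 0.
  by apply/eqP => /cosz_eq0/dvdz_small; lia.
have no34 : z ^ u3 + z ^ (- u4) != 0.
  apply/eqP => /eqP; rewrite addr_eq0 => /eqP/primz_opp/dvdz_small; lia.
have zc a b : z ^ a = z ^ b -> c a = c b.
  by move=> e; rewrite /c -!invr_expz e.
have cpm a b : a = b \/ a = - b -> c a = c b by case=> ->.
pose D r v := (d %| v - r)%Z.
have SE r : class_sum (cos_terms u1 u2 u3 u4) z d r =
    ((if D r u1 then z ^ u1 else 0) + (if D r (- u1) then z ^ (- u1) else 0)) +
    ((if D r u2 then z ^ u2 else 0) + (if D r (- u2) then z ^ (- u2) else 0)) -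
    ((if D r u3 then z ^ u3 else 0) + (if D r (- u3) then z ^ (- u3) else 0)) -
    ((if D r u4 then z ^ u4 else 0) + (if D r (- u4) then z ^ (- u4) else 0)).
  exact: class_sum_cos_terms.
have DN r v : D (- r) v = D r (- v).
  by rewrite /D -dvdz_opp; congr (_ %| _)%Z; ring.
have pick r u : ~~ (d %| 2 * r)%Z -> exists v (a : bool), [/\ v = u \/ v = - u,
    (if D r u then z ^ u else 0) + (if D r (- u) then z ^ (- u) else 0) = a%:R *
      z ^ v &
    (if D (- r) u then z ^ u else 0) + (if D (- r) (- u) then z ^ (- u) else 0)
      =
      a%:R * z ^ (- v)].
  move=> nr; rewrite !DN opprK.
  case: (boolP (D r u)) => d1; case: (boolP (D r (- u))) => d2.
  - case/negP: nr; have := rpredD d1 d2.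
    by rewrite -dvdz_opp; congr (_ %| _)%Z; ring.
  - by exists u, true; rewrite !mul1r addr0 add0r; split; [left| |].
  - by exists (- u), true; rewrite !mul1r addr0 add0r opprK; split; [right| |].
  - by exists u, false; rewrite !mul0r addr0; split; [left| |].
(* Is u3 congruent to - u3 modulo d? *)
have [self3|nself3] := boolP (d %| 2 * u3)%Z.
  have nself4 : ~~ (d %| 2 * u4)%Z.
    apply: contra nd4 => self4; have := rpredB self3 self4.
    by have -> : 2 * u3 - 2 * u4 = 4 by rewrite /u3 /u4; ring.
  have D0 : D u4 u3 = false.
    apply/negP => h; case/negP: nd4; have := rpredD h h.
    by have -> : u3 - u4 + (u3 - u4) = 4 by rewrite /u3 /u4; ring.
  have D1 : D u4 (- u3) = false.
    apply/negP => h; case/negP: nself4; have := rpredD (rpredD h h) self3.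
    by rewrite -dvdz_opp; congr (_ %| _)%Z; ring.
  have D2 : D u4 (- u4) = false.
    apply/negP => h; case/negP: nself4.
    by rewrite -dvdz_opp; congr (_ %| _)%Z: h; ring.
  have D3 : D u4 u4 by rewrite /D subrr dvdz0.
  have [v1 [a1 [Hv1 P1 Q1]]] := pick u4 u1 nself4.
  have [v2 [a2 [Hv2 P2 Q2]]] := pick u4 u2 nself4.
  have := S0 u4; have := S0 (- u4); rewrite !SE P1 P2 Q1 Q2 !DN !opprK.
  rewrite D0 D1 D2 D3 !addr0 !add0r !subr0.
  case: a1 {P1 Q1}; case: a2 {P2 Q2}; rewrite ?mul1r ?mul0r ?add0r ?addr0.
  - move=> /eqP; rewrite subr_eq0 => /eqP e1 /eqP; rewrite subr_eq0 => /eqP e2.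
    have c3 : c u3 = 0.
      apply: (addIr (c u4)); rewrite -E add0r -(cpm _ _ Hv1) -(cpm _ _ Hv2).
      by rewrite /c addrACA e1 e2.
    have hx2 : (2 * x + 2 = n)%N by move: c3 => /cosz_eq0/dvdz_small;
      rewrite /u3; clear - n4 hx; lia.
    have e12 : z ^ v1 * z ^ v2 = z ^ u4 * z ^ u4.
      move: e1; rewrite -e2 -!invr_expz -e2 => e1.
      have z12 : z ^ v1 + z ^ v2 != 0 by rewrite e2.
      apply/eqP; rewrite -subr_eq0.
      have -> : z ^ v1 * z ^ v2 - (z ^ v1 + z ^ v2) * (z ^ v1 + z ^ v2) =
        z ^ v1 * z ^ v2 * (z ^ v1 + z ^ v2) *
        ((z ^ v1 + z ^ v2)^-1 - ((z ^ v1)^-1 + (z ^ v2)^-1)).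
        by field; rewrite !zn0 z12.
      by rewrite e1 subrr mulr0.
    have e12' : z ^ (v1 + v2) = z ^ (u4 + u4).
      by rewrite (expfzDr v1) // e12 (expfzDr u4).
    have d12 := primz_eq e12'.
    have /cosz_eq1 d1 : z ^ (v1 - u4) + z ^ (- (v1 - u4)) = 1.
      have -> : z ^ (- (v1 - u4)) = z ^ (v2 - u4).
        have -> : v2 - u4 = (v1 + v2) + (- v1 - u4) by ring.
        by rewrite expfzDr // e12' -expfzDr //; congr (z ^ _); ring.
      by rewrite !(expfzDr _ (- u4)) // -mulrDl e2 -expfzDr // subrr expr0z.
    constructor 2; exact: third_half_triple d12 d1.
  - move=> _ /eqP; rewrite subr_eq0 => /eqP/zc e; apply: T14.
    by rewrite -e; apply/esym/cpm.
  - move=> _ /eqP; rewrite subr_eq0 => /eqP/zc e; apply: T24.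
    by rewrite -e; apply/esym/cpm.
  - by move=> _ /eqP; rewrite oppr_eq0 (negPf (zn0 _)).
have D0 : D u3 u4 = false.
  apply/negP => h; case/negP: nd4; have := rpredD h h; rewrite -dvdz_opp.
  by have -> : - (u4 - u3 + (u4 - u3)) = 4 by rewrite /u3 /u4; ring.
have D1 : D u3 (- u3) = false.
  apply/negP => h; case/negP: nself3.
  by rewrite -dvdz_opp; congr (_ %| _)%Z: h; ring.
have D3 : D u3 u3 by rewrite /D subrr dvdz0.
have [v1 [a1 [Hv1 P1 Q1]]] := pick u3 u1 nself3.
have [v2 [a2 [Hv2 P2 Q2]]] := pick u3 u2 nself3.
have := S0 u3; have := S0 (- u3); rewrite !SE P1 P2 Q1 Q2 !DN !opprK.
rewrite D0 D1 D3 !addr0 !add0r.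
case: (D u3 (- u4)); case: a1 {P1 Q1}; case: a2 {P2 Q2};
  rewrite ?mul1r ?mul0r ?add0r ?addr0 ?subr0.
- move=> e1 e2.
  have {}e1 : (z ^ v1)^-1 + (z ^ v2)^-1 = (z ^ u3)^-1 + (z ^ (- u4))^-1.
    by rewrite !invr_expz opprK; apply/eqP; rewrite -subr_eq0 opprD addrA e1.
  have {}e2 : z ^ v1 + z ^ v2 = z ^ u3 + z ^ (- u4).
    by apply/eqP; rewrite -subr_eq0 opprD addrA e2.
  case: (two_units_sum (zn0 _) (zn0 _) (zn0 _) (zn0 _) e2 e1) =>
    [[/zc e _]|[/zc e _]|].
  + by apply: T13; rewrite -e; apply/esym/cpm.
  + by apply: T14; rewrite -[c u4]cN -e; apply/esym/cpm.
  + by rewrite e2 => /eqP; rewrite (negPf no34).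
- move=> /eqP; rewrite -addrA -opprD subr_eq0 => /eqP e1.
  move=> /eqP; rewrite -addrA -opprD subr_eq0 => /eqP e2.
  have /cosz_eq0/dvdz_small : c u2 = 0.
    apply: (addrI (c u1)); rewrite E addr0 -(cpm _ _ Hv1) /c e1 e2.
    by rewrite [z ^ u4 + _]addrC addrACA.
  rewrite /u2; clear - n4 hy hw; lia.
- move=> /eqP; rewrite -addrA -opprD subr_eq0 => /eqP e1.
  move=> /eqP; rewrite -addrA -opprD subr_eq0 => /eqP e2.
  have /cosz_eq0/dvdz_small h1 : c u1 = 0.
    apply: (addIr (c u2)); rewrite E add0r -(cpm _ _ Hv2) /c e1 e2.
    by rewrite [z ^ u4 + _]addrC addrACA.
  (* Here z^u3 + z^(-u4) = z (z^x + z^(-x)). *)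
  have e2' : z ^ (v2 - 1) = c x%:Z.
    rewrite expfzDr // e2 mulrDl -!expfzDr // /c; congr (z ^ _ + z ^ _);
      rewrite /u3 /u4; ring.
  have e1' : z ^ (1 - v2) = c x%:Z.
    rewrite addrC expfzDr // e1 mulrDl -!expfzDr // /c addrC;
      congr (z ^ _ + z ^ _); rewrite /u3 /u4; ring.
  have h2 : v2 = 1.
    have /primz_eq/dvdz_small : z ^ (v2 - 1) = z ^ (1 - v2) by rewrite e1' e2'.
    move: Hv2; rewrite /u2; clear - n4 hy hw; lia.
  have /cosz_eq1/dvdz_small h3 : c x%:Z = 1 by rewrite -e1' h2 subrr expr0z.
  constructor 3; apply: third_quarter_triple.
  + by move: h3; clear - n4 hx; lia.
  + by move: h1; rewrite /u1; clear - n4 hy hw; lia.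
  + by move: Hv2; rewrite h2 /u2; clear; lia.
- by move=> _ /eqP; rewrite -opprD oppr_eq0 (negPf no34).
- move=> /eqP; rewrite subr_eq0 => /eqP e1 /eqP; rewrite subr_eq0 => /eqP e2.
  case/eqP: no4; apply: (addrI (c u3));
    rewrite -E addr0 -(cpm _ _ Hv1) -(cpm _ _ Hv2).
  by rewrite /c addrACA e1 e2.
- move=> _ /eqP; rewrite subr_eq0 => /eqP/zc e; apply: T13.
  by rewrite -e; apply/esym/cpm.
- move=> _ /eqP; rewrite subr_eq0 => /eqP/zc e; apply: T23.
  by rewrite -e; apply/esym/cpm.
- by move=> _ /eqP; rewrite oppr_eq0 (negPf (zn0 _)).
Qed.

End Split.

(** * Moduli for which all class sums vanish *)

Lemma coprime_1_addM (j m N : nat) :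
  (forall q, prime q -> (q %| N)%N -> (q %| m)%N) -> coprime (1 + j * m) N.
Proof.
move=> qm; apply/negPn/negP => nco.
pose q := pdiv (gcdn (1 + j * m) N).
have g1 : (1 < gcdn (1 + j * m) N)%N.
  by rewrite ltn_neqAle eq_sym nco gcdn_gt0.
have pq : prime q by exact: pdiv_prime.
have /andP[q1 q2] : (q %| 1 + j * m)%N && (q %| N)%N by rewrite -dvdn_gcd
  pdiv_dvd.
move: q1; rewrite dvdn_addl ?dvdn_mull ?qm // dvdn1 => /eqP q1.
by rewrite q1 in pq.
Qed.

Lemma missed_residue (p : nat) (s : seq int) : (0 < p)%N -> (size s < p)%N ->
  exists r : int, forall v, v \in s -> ~~ (p %| v - r)%Z.
Proof.
move=> p0 sp; pose t := [seq absz (v %% p)%Z | v <- s].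
have [/allP sub|/allPn[r rp rt]] := boolP (all (mem t) (iota 0 p)).
  have /leq_trans : (size (iota 0 p) <= size t)%N by apply:
    uniq_leq_size (iota_uniq _ _) sub.
  by rewrite size_iota size_map => /(_ _ (leqnn _)); rewrite leqNgt sp.
exists r%:Z => v vs; apply: contra rt; rewrite -eqz_mod_dvd => /eqP vr.
have rr : 0 <= r%:Z < p%:Z by move: rp; rewrite mem_iota; lia.
by apply/mapP; exists v => //; rewrite vr (modz_small rr).
Qed.

Section Classify.
Variables (F : numFieldType) (n : nat) (z : F).
Hypothesis pz : (2 * n).-primitive_root z.

(** If the class of r0 is empty, the common value of the class sums, up to roots
    of unity, is 0. *)
Lemma class_sum0_of_missed (V : seq (int * int)) p r0 :
  prime p -> (p %| 2 * n)%N -> expsum V z = 0 -> class_sum V z p r0 = 0 ->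
  forall r, class_sum V z p r = 0.
Proof.
move=> pp pN V0 S0; have [j0 Hj] := class_sum_prime pz pp pN V0.
move=> r; have := Hj r; rewrite -(Hj r0) S0 mul0r => /eqP.
rewrite mulf_eq0 => /orP[/eqP //|].
by rewrite expfz_eq0 expf_eq0 (negPf (prim_root_neq0 pz)) !andbF.
Qed.

Lemma class_sum_missed (V : seq (int * int)) (p : nat) (r : int) :
  (forall v, v \in unzip2 V -> ~~ (p %| v - r)%Z) -> class_sum V z p r = 0.
Proof.
move=> nr; rewrite /class_sum big1_seq // => t /andP[d tV].
by case/negP: (nr _ (map_f snd tV)).
Qed.

Variables (x y w : nat).
Hypothesis (n4 : (4 < n)%N) (hx : (2 * x < n)%N) (hy : (2 * y < n)%N)
  (hw : (2 * w < n)%N).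
Let V := cos_terms (y%:Z + w%:Z) (y%:Z - w%:Z) (x%:Z + 1) (x%:Z - 1).
Hypothesis V0 : expsum V z = 0.

(** If every prime factor of 2 n divides 2 n / d, then all 1 + j (2 n / d) are
    prime to 2 n. *)
Lemma classify_split d : (0 < d)%N -> (d %| 2 * n)%N -> ~~ (d %| 4)%N ->
  (forall q, prime q -> (q %| 2 * n)%N -> (q %| 2 * n %/ d)%N) ->
  trivial_or_family n x y w.
Proof.
move=> d0 dN nd4 hd; apply: (split_classification pz n4 hx hy hw nd4 V0).
move=> r; apply: (class_sum_eq0 r pz d0 dN _ V0) => j.
exact: coprime_1_addM.
Qed.

Lemma classify_8 : (8 %| n)%N -> trivial_or_family n x y w.
Proof.
move=> d8; have d16 : (8 %| 2 * n)%N by rewrite dvdn_mull.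
apply: (@classify_split 8) => // q pq qn.
have D : (2 * n = (2 * n %/ 8) * 8)%N by rewrite divnK.
have := qn; rewrite [in X in X -> _]D Euclid_dvdM // => /orP[//|q8].
have -> : q = 2%N.
  by apply/eqP; move: q8; rewrite (Euclid_dvdX 2 3 pq) /= andbT dvdn_prime2.
by lia.
Qed.

Lemma classify_prime_square p : prime p -> odd p -> (p ^ 2 %| n)%N ->
  trivial_or_family n x y w.
Proof.
move=> pp op p2; have p0 := prime_gt0 pp.
have pn : (p ^ 2 %| 2 * n)%N by rewrite dvdn_mull.
have pN : (p %| 2 * n)%N by apply: dvdn_trans pn; rewrite expnS dvdn_mulr.
apply: (@classify_split p) => //.
  apply/negP; rewrite (Euclid_dvdX 2 2 pp) andbT dvdn_prime2 // => /eqP p2'.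
  by rewrite p2' in op.
move=> q pq qn.
have D : (2 * n = (2 * n %/ p) * p)%N by rewrite divnK.
have := qn; rewrite [in X in X -> _]D Euclid_dvdM // => /orP[//|].
rewrite dvdn_prime2 // => /eqP ->.
by rewrite dvdn_divRL // -expnSr.
Qed.

Lemma odd_prime_ndvd4 p : prime p -> (2 < p)%N -> ~~ (p %| 4)%N.
Proof.
move=> pp p2; apply/negP; rewrite (Euclid_dvdX 2 2 pp) andbT dvdn_prime2 // =>
  /eqP p2'.
by rewrite p2' in p2.
Qed.

Lemma classify_large_prime p : prime p -> (8 < p)%N -> (p %| n)%N ->
  trivial_or_family n x y w.
Proof.
move=> pp p8 pn; have pN : (p %| 2 * n)%N by rewrite dvdn_mull.
apply: (split_classification pz n4 hx hy hw (odd_prime_ndvd4 pp _) V0);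
  first exact: ltn_trans p8.
have [r0 nr0] := @missed_residue p (unzip2 V) (prime_gt0 pp) p8.
by apply: (class_sum0_of_missed pp pN V0) (class_sum_missed nr0).
Qed.

End Classify.

(** * The modulus seven *)

(** The residues a and b modulo 7 are distinct up to sign. *)
Definition indep7 (a b : nat) : bool := (a != b) && ((a + b) %% 7 != 0)%N.
(** Every residue modulo 7 is, up to sign, in the list s. *)
Definition covers7 (s : seq nat) : bool :=
  all (fun r => has (fun a => (r == a) || ((r + a) %% 7 == 0)%N) s) (iota 0 7).

(** There are four residues modulo 7 up to sign, so that four residues covering
    all of them are distinct up to sign. *)
Lemma covers7_pairwise (a b c d : nat) :
  (a < 7)%N -> (b < 7)%N -> (c < 7)%N -> (d < 7)%N ->
  covers7 [:: a; b; c; d] -> pairwise indep7 [:: a; b; c; d].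
Proof.
have : all (fun s => covers7 s ==> pairwise indep7 s)
  [seq [:: p.1.1; p.1.2; p.2.1; p.2.2] |
    p <- [seq (p, q) | p <- [seq (i, j) | i <- iota 0 7, j <- iota 0 7],
                       q <- [seq (i, j) | i <- iota 0 7, j <- iota 0 7]]].
  by vm_compute.
move=> /allP H ha hb hc hd; apply/implyP/H/mapP; exists ((a, b), (c, d)) => //.
apply/allpairsP; exists ((a, b), (c, d)); split=> //;
  by apply/allpairsP; eexists (_, _); split; rewrite // mem_iota.
Qed.

Lemma indep7_int (u v : int) :
  indep7 `|(u %% 7)%Z| `|(v %% 7)%Z| ->
  ~~ (7 %| u - v)%Z && ~~ (7 %| u + v)%Z.
Proof. rewrite /indep7; lia. Qed.

Lemma residues7 (u1 u2 u3 u4 : int) :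
  (forall r : nat, (r < 7)%N ->
     has (fun v => (7 %| v - r%:Z)%Z) (unzip2 (cos_terms u1 u2 u3 u4))) ->
  pairwise (fun u v : int => ~~ (7 %| u - v)%Z && ~~ (7 %| u + v)%Z)
    [:: u1; u2; u3; u4].
Proof.
move=> H; have lt7 (u : int) : (`|(u %% 7)%Z| < 7)%N by lia.
have : pairwise indep7 [seq `|(u %% 7)%Z|%N | u <- [:: u1; u2; u3; u4]].
  apply: covers7_pairwise => //; apply/allP => r rin.
  rewrite mem_iota add0n in rin.
  have /hasP[v] := H r rin; rewrite !inE /=.
  have step (u : int) : (v == u) || (v == - u) -> (7 %| v - r%:Z)%Z ->
    (r == `|(u %% 7)%Z|)%N || ((r + `|(u %% 7)%Z|) %% 7 == 0)%N.
    by case/orP => /eqP ->; lia.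
  move=> hv dv; rewrite !orbF.
  have : [|| (v == u1) || (v == - u1), (v == u2) || (v == - u2), (v == u3) ||
    (v == - u3) |
    (v == u4) || (v == - u4)] by move: hv; rewrite -!orbA.
  by case/or4P => /step -> //; rewrite ?orbT.
rewrite pairwise_map; apply: sub_pairwise => u v; exact: indep7_int.
Qed.

Section Classify7.
Variables (F : numFieldType) (n : nat) (z : F).
Hypothesis pz : (2 * n).-primitive_root z.
Variables (x y w : nat).
Hypothesis (n4 : (4 < n)%N) (hx : (2 * x < n)%N) (hy : (2 * y < n)%N)
  (hw : (2 * w < n)%N).
Let V := cos_terms (y%:Z + w%:Z) (y%:Z - w%:Z) (x%:Z + 1) (x%:Z - 1).
Hypothesis V0 : expsum V z = 0.

Lemma dvd_2n (a : int) : (2 * n %| 2 * a)%Z = (n %| a)%Z.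
Proof. by rewrite PoszM dvdz_mul2l. Qed.

Lemma cosz_sqr_eq1 (a : int) : (z ^ a + z ^ (- a)) ^+ 2 = 1 -> (n %| 3 * a)%Z.
Proof.
have z0 := prim_root_neq0 pz.
have Nn : (n%:Z %| (2 * n)%N%:Z)%Z by rewrite dvdzE /= dvdn_mull.
move/eqP; rewrite sqrf_eq1 => /orP[/eqP e|/eqP e].
  have := rpredD (dvdz_trans Nn (cosz_eq1 pz e)) (dvdzz n).
  by rewrite subrK.
have zn : z ^ (- n%:Z) = -1 by rewrite -invr_expz (primz_half pz) invrN1.
have e' : z ^ (a + n%:Z) + z ^ (- (a + n%:Z)) = 1.
  by rewrite opprD !expfzDr // zn (primz_half pz) -mulrDl e mulrNN mulr1.
have := rpredB (dvdz_trans Nn (cosz_eq1 pz e')) (dvdz_mull 2 (dvdzz n)).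
by congr (_ %| _)%Z; ring.
Qed.

(** If all residues are met, the u_i are distinct up to sign modulo 7.  Let u be
    u3 or u4.  If 7 does not divide u, comparing the class sums at u and - u
    shows that z^(14 u) = 1.  Otherwise the class sum at 0 is
    - (z^u + z^(-u)), and comparing it with those at u1 and - u1 shows that its
    square is 1, so that z^(6 u) = 1.  In all cases n divides 21 u3 and 21 u4,
    hence 21 (u3 - u4) = 42. *)
Lemma classify_7 : (7 %| n)%N -> trivial_or_family n x y w \/ (n %| 42)%N.
Proof.
move=> n7; have pN : (7 %| 2 * n)%N by rewrite dvdn_mull.
have z0 := prim_root_neq0 pz; have p7 : prime 7 by [].
(* Either some residue modulo 7 is missed by all exponents, or none is. *)
have [/hasP[r0 _ /allP nr0]|H] :=
  boolP (has (fun r : nat => all (fun v => ~~ (7 %| v - r%:Z)%Z) (unzip2 V))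
    (iota 0 7)).
  left; apply: (split_classification pz n4 hx hy hw (isT : ~~ (7 %| 4)%N) V0).
  by apply: (class_sum0_of_missed pz p7 pN V0) (class_sum_missed z nr0).
right.
have [j0 Hj] := class_sum_prime pz p7 pN V0; set m := (_ %/ _)%N in Hj.
have Dm : (m * 7 = 2 * n)%N by rewrite divnK.
have : pairwise (fun u v : int => ~~ (7 %| u - v)%Z && ~~ (7 %| u + v)%Z)
  [:: y%:Z + w%:Z; y%:Z - w%:Z; x%:Z + 1; x%:Z - 1].
  apply: residues7 => r r7; move/hasPn: H => /(_ r); rewrite mem_iota =>
    /(_ r7).
  by rewrite -has_predC; apply: sub_has => v /=; rewrite negbK.
have zm0 : z ^+ m != 0 by rewrite expf_neq0.
pose q (u : int) := z ^ u * (z ^+ m) ^ (u * j0%:Z).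
have qN u : q (- u) = (q u)^-1 by rewrite /q mulNr -!invr_expz invfM.
have q7 u : q u ^+ 2 = 1 -> (n %| 7 * u)%Z.
  move=> e; rewrite -dvd_2n.
  have : (2 * n %| 2 * (7 * u) + (2 * n)%N%:Z * (2 * u * j0%:Z))%Z.
    rewrite -(prim_exprz_eq1 _ pz).
    have -> : 2 * (7 * u) + (2 * n)%N%:Z * (2 * u * j0%:Z) =
      (u + m%:Z * (u * j0%:Z)) * 2 * 7.
      by rewrite -Dm PoszM; ring.
    rewrite -exprz_exp -(exprz_exp _ _ 2) expfzDr // -(exprz_exp _ m%:Z).
    by rewrite -!exprnP -/(q u) e expr1n.
  move/rpredB/(_ (dvdz_mulr (2 * u * j0%:Z) (dvdzz (2 * n)%N))).
  by rewrite addrK.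
rewrite /V; move: Hj; rewrite /V.
set u1 := y%:Z + w%:Z; set u2 := y%:Z - w%:Z; set u3 := x%:Z + 1;
  set u4 := x%:Z - 1.
move=> Hj /=; rewrite !andbT => /and3P[].
have sep a b : ~~ (7 %| a - b)%Z && ~~ (7 %| a + b)%Z ->
    (((7 %| a - b)%Z = false) * ((7 %| - a - b)%Z = false) *
     ((7 %| a - - b)%Z = false) * ((7 %| - a - - b)%Z = false) *
     ((7 %| b - a)%Z = false) * ((7 %| - b - a)%Z = false) *
     ((7 %| b - - a)%Z = false) * ((7 %| - b - - a)%Z = false))%type.
  by clear=> *; do ![split]; lia.
move=> /and3P[/sep s12 /sep s13 /sep s14] /andP[/sep s23 /sep s24] /sep s34.
have self a : ((7 %| a - a)%Z = true) * ((7 %| - a - - a)%Z = true).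
  by clear=> *; do ![split]; lia.
have nself a : ~~ (7 %| a)%Z -> ((7 %| - a - a)%Z = false) *
  ((7 %| a - - a)%Z = false).
  by clear=> *; do ![split]; lia.
have SE := class_sum_cos_terms z 7 _ u1 u2 u3 u4.
set S0 := class_sum _ _ _ 0 in Hj.
have q1 : ~~ (7 %| u1)%Z -> q u1 = S0 /\ q (- u1) = S0.
  move=> /nself n1; have := Hj u1; have := Hj (- u1); rewrite !SE.
  by rewrite ?(s12, s13, s14, self, n1) !(add0r, addr0, subr0).
have q3 : ~~ (7 %| u3)%Z -> q u3 = - S0 /\ q (- u3) = - S0.
  move=> /nself n1; have := Hj u3; have := Hj (- u3); rewrite !SE.
  rewrite ?(s13, s23, s34, self, n1) !(add0r, addr0, subr0, sub0r, mulNr) =>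
    e1 e2.
  by split; [rewrite -e2|rewrite -e1]; rewrite opprK /q ?mulNr.
have q4 : ~~ (7 %| u4)%Z -> q u4 = - S0 /\ q (- u4) = - S0.
  move=> /nself n1; have := Hj u4; have := Hj (- u4); rewrite !SE.
  rewrite ?(s14, s24, s34, self, n1) !(add0r, addr0, subr0, sub0r, mulNr) =>
    e1 e2.
  by split; [rewrite -e2|rewrite -e1]; rewrite opprK /q ?mulNr.
have sq u s : q u = s /\ q (- u) = s -> q u ^+ 2 = 1.
  case=> e1 e2; rewrite expr2 e1 -{1}e1 -e2 qN divff //.
  by rewrite mulf_neq0 ?expfz_neq0.
have S0E u : u = u3 \/ u = u4 -> (7 %| u)%Z -> (z ^ u + z ^ (- u)) ^+ 2 = 1.
  move=> hu du.
  have nu1 : ~~ (7 %| u1)%Z.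
    by apply/negP => d1; have := rpredB d1 du; case: hu => ->;
      rewrite ?s13 ?s14.
  have <- := sq _ _ (q1 nu1); rewrite (q1 nu1).1.
  suff -> : S0 = - (z ^ u + z ^ (- u)) by rewrite sqrrN.
  have nd v : (7 %| v - u)%Z = false -> (7 %| v)%Z = false.
    by move=> h; apply/negP => dv; move: (rpredB dv du); rewrite h.
  have neg v : (7 %| - v)%Z = (7 %| v)%Z by rewrite dvdz_opp.
  rewrite /S0 SE /= !subr0 !neg; case: hu nd du => -> nd du; rewrite du.
    rewrite (nd u1) ?(nd u2) ?(nd u4) ?(s13, s23, s34) //.
    by rewrite !(add0r, addr0, subr0).
  rewrite (nd u1) ?(nd u2) ?(nd u3) ?(s14, s24, s34) //.
  by rewrite !(add0r, addr0, subr0).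
have n21 u : u = u3 \/ u = u4 -> (n %| 21 * u)%Z.
  move=> hu; have [du|ndu] := boolP (7 %| u)%Z.
    have := dvdz_mull 7 (cosz_sqr_eq1 (S0E _ hu du)).
    by congr (_ %| _)%Z; ring.
  have : q u ^+ 2 = 1 by case: hu ndu => -> ndu;
    [apply: sq (q3 ndu)|apply: sq (q4 ndu)].
  move/q7/(dvdz_mull 3); by congr (_ %| _)%Z; ring.
have := rpredB (n21 _ (or_introl erefl)) (n21 _ (or_intror erefl)).
have -> : 21 * u3 - 21 * u4 = 42 by rewrite /u3 /u4; ring.
by [].
Qed.
End Classify7.

(** The classification up to finitely many values of n. *)
Lemma classify_up_to_60 (F : numFieldType) (n : nat) (z : F) (x y w : nat) :
  (2 * n).-primitive_root z ->
  (4 < n)%N -> (2 * x < n)%N -> (2 * y < n)%N -> (2 * w < n)%N ->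
  expsum (cos_terms (y%:Z + w%:Z) (y%:Z - w%:Z) (x%:Z + 1) (x%:Z - 1)) z = 0 ->
  [\/ trivial_or_family n x y w, (n %| 42)%N | (n %| 60)%N].
Proof.
move=> pz n4 hx hy hw V0.
have [d7|nd7] := boolP (7 %| n)%N.
  by case: (classify_7 pz n4 hx hy hw V0 d7); [constructor 1|constructor 2].
have [d8|nd8] := boolP (8 %| n)%N; first by constructor 1; apply:
  classify_8 V0 d8.
have [/hasP[p]|np] := boolP (has (fun p =>
  (odd p && (p ^ 2 %| n)%N) || (8 < p)%N) (primes n)).
  rewrite mem_primes => /and3P[pp _ pn] /orP[/andP[op p2]|p8]; constructor 1.
    exact: classify_prime_square V0 _ pp op p2.
  exact: classify_large_prime V0 _ pp p8 pn.
(* Only 4, 3 and 5 remain as maximal prime power factors of n. *)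
constructor 3; have n0 : (0 < n)%N by lia.
apply/dvdn_partP => // p; rewrite mem_primes => /and3P[pp _ pn].
have := hasPn np p; rewrite mem_primes pp n0 pn => /(_ isT).
rewrite negb_or -leqNgt => /andP[np2 p8].
have np7 : p != 7%N by apply: contraNneq nd7 => <-.
have [p2|op] := even_prime pp.
  rewrite p2 p_part; have : (logn 2 n < 3)%N by rewrite ltnNge
    -(pfactor_dvdn 3).
  by case: (logn 2 n) => [|[|[|]]].
rewrite op /= in np2.
have l1 : (logn p n < 2)%N by rewrite ltnNge -pfactor_dvdn.
have H : p = 3%N \/ p = 5%N.
  have : all (fun p => [&& prime p, odd p & p != 7] ==> (p \in [:: 3; 5]))
    (iota 0 9).
    by [].
  move/allP/(_ p); rewrite mem_iota /= ltnS p8 pp op np7 => /(_ isT).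
  by rewrite !inE => /orP[] /eqP; [left|right].
by rewrite p_part; case: H => pE; move: l1; rewrite pE; case: (logn _ n) =>
  [|[|]].
Qed.

(** * The finitely many remaining levels *)

Local Open Scope nat_scope.
(** The list of the g^i modulo q for i = 0, ..., N. *)
Definition mod_powers (q g N : nat) : seq nat :=
  traject (fun a => (a * g) %% q) 1 N.+1.

(** Tests that g has order N modulo q. *)
Definition mod_prim_root (q g N : nat) : bool :=
  let t := mod_powers q g N in
  (0 < N) && all (fun i => (nth 0 t i.+1 == 1) == (i.+1 == N)) (iota 0 N).

(** The list of the g^i + g^(N - i) for i = 0, ..., N: twice the cosines, up to
    a congruence modulo q. *)
Definition mod_cosines (q g N : nat) : seq nat :=
  let t := mod_powers q g N in [seq nth 0 t i + nth 0 t (N - i) | i <- iota 0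
    N.+1].

(** The sums of the entries a and b of each table, reduced modulo q. *)
Definition mod_sums (q a b : nat) (cs : seq (seq nat)) : seq nat :=
  [seq (nth 0 c a + nth 0 c b) %% q | c <- cs].

(** The indices of the positive cosines. *)
Definition half_range (n : nat) := [seq x <- iota 0 n | 2 * x < n].

(** The exceptional triples (n, l, m) whose first entry divides 42 or 60. *)
Definition small_pairs : seq (nat * nat * nat) :=
  [:: (12, 4, 5);
      (30, 10, 14); (30, 13, 14); (30, 10, 13); (30, 7, 10); (30, 8, 10);
      (30, 7, 8); (30, 4, 6); (30, 4, 7); (30, 6, 7); (30, 6, 10); (30, 6, 11);
      (30, 10, 11); (30, 8, 12); (30, 8, 13); (30, 12, 13);
      (60, 20, 29); (60, 28, 29); (60, 20, 28);
      (42, 14, 20); (42, 19, 20); (42, 14, 19); (42, 10, 14); (42, 11, 14);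
      (42, 10, 11); (42, 6, 12); (42, 6, 13); (42, 12, 13)].

(** The solution is trivial, or each pair a < b of its entries with 1 < a is
    exceptional at level n. *)
Definition known_solution (n x y w : nat) : bool :=
  [|| (y == 1) && (w == x), (w == 1) && (y == x) |
      all (fun a => all (fun b => (1 < a < b) ==> ((n, a, b) \in small_pairs))
                      [:: x; y; w]) [:: x; y; w]].

(** Every triple solving the equation modulo q, for all tables of cosines, is
    known.  The distance |y - w| is encoded as (y - w) + (w - y), with truncated
    subtractions, and |x - 1| likewise. *)
Definition check_solutions (q n : nat) (cs : seq (seq nat)) : bool :=
  let lhs := [seq (x, mod_sums q (x + 1) ((x - 1) + (1 - x)) cs)
             | x <- half_range n] in
  all (fun y => all (fun w =>
    let rhs := mod_sums q (y + w) ((y - w) + (w - y)) cs in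
    all (fun p => if odd (p.1 + y + w) then
                    if p.2 == rhs then known_solution n p.1 y w else true
                  else true)
      lhs) (half_range n)) (half_range n).

(** The elements gs are roots of unity of order 2 n modulo the prime q, and the
    equation at level n has only known solutions modulo q. *)
Definition check_level (q n : nat) (gs : seq nat) : bool :=
  [&& prime q, all (fun g => mod_prim_root q g (2 * n)) gs &
    check_solutions q n [seq mod_cosines q g (2 * n) | g <- gs]].

(** 336 is a multiple of 84 and 240 one of 120, so the roots of unity exist.
    For n = 42 and n = 60 one of them leaves unwanted solutions modulo q, and a
    second one is used. *)
Lemma check_levels :
  all (fun p => check_level p.1.1 p.1.2 p.2)
    [:: (337, 7, [:: 42]); (337, 14, [:: 36]); (337, 21, [:: 21]);
        (337, 42, [:: 9; 18]); (241, 10, [:: 6]); (241, 12, [:: 2]);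
        (241, 15, [:: 10]); (241, 20, [:: 5]); (241, 30, [:: 9]);
        (241, 60, [:: 3; 12])].
Proof. by vm_compute. Qed.

Local Open Scope ring_scope.
Section ModPrime.
Variables (q : nat) (pq : prime q).

(** The tables do represent powers and cosines in the field with q elements. *)
Lemma nth_mod_powers g N i : (i <= N)%N ->
  (nth 0%N (mod_powers q g N) i)%:R = g%:R ^+ i :> 'F_q.
Proof.
move=> iN; rewrite /mod_powers (set_nth_default 1%N) ?size_traject ?ltnS //
  nth_traject ?ltnS //.
elim: i {iN} => [|i IH] //=; rewrite Fp_nat_mod // natrM IH exprSr.
by [].
Qed.

Lemma nth_mod_powers_lt g N i : (i <= N)%N ->
  (nth 0 (mod_powers q g N) i < q)%N.
Proof.
move=> iN; rewrite /mod_powers (set_nth_default 1%N) ?size_traject ?ltnS //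
  nth_traject ?ltnS //.
by case: i {iN} => [|i] /=; [exact: prime_gt1|rewrite ltn_mod prime_gt0].
Qed.

Lemma natr_Fp_eq (a b : nat) : (a%:R == b%:R :> 'F_q) = (a == b %[mod q]).
Proof. by rewrite -val_eqE /= !val_Fp_nat. Qed.

Lemma mod_prim_rootP g N : mod_prim_root q g N ->
  N.-primitive_root (g%:R : 'F_q).
Proof.
move=> /andP[N0 /allP H]; rewrite /primitive_root_of_unity N0 /=.
apply/forallP => i; rewrite unity_rootE.
have /H/eqP <- : (i : nat) \in iota 0 N by rewrite mem_iota /=.
rewrite -(nth_mod_powers g (ltn_ord i)) -[1]/(1%:R) natr_Fp_eq modn_small
  ?nth_mod_powers_lt //.
by rewrite modn_small ?prime_gt1.
Qed.

Lemma mod_cosinesE g N i : (i <= N)%N -> N.-primitive_root (g%:R : 'F_q) ->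
  (nth 0%N (mod_cosines q g N) i)%:R = g%:R ^ i%:Z + g%:R ^ (- i%:Z) :> 'F_q.
Proof.
move=> iN pg; rewrite /mod_cosines (nth_map 0%N) ?size_iota ?ltnS // nth_iota
  ?ltnS // add0n.
rewrite natrD !nth_mod_powers ?leq_subr //; congr (_ + _).
have g0 := prim_root_neq0 pg.
apply: (mulfI (expf_neq0 i g0)); rewrite -exprD subnKC // (prim_expr_order pg).
by rewrite exprnP -expfzDr // subrr expr0z.
Qed.

Lemma mod_sumsE (n x y w : nat) (gs : seq nat) :
  (2 * x < n)%N -> (2 * y < n)%N -> (2 * w < n)%N ->
  (forall g, g \in gs -> (2 * n).-primitive_root (g%:R : 'F_q) /\
    expsum (cos_terms (y%:Z + w%:Z) (y%:Z - w%:Z) (x%:Z + 1) (x%:Z - 1))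
      (g%:R : 'F_q) = 0) ->
  let cs := [seq mod_cosines q g (2 * n) | g <- gs] in
  mod_sums q (x + 1) ((x - 1) + (1 - x)) cs = mod_sums q (y + w)
    ((y - w) + (w - y)) cs.
Proof.
move=> hx hy hw H; rewrite /mod_sums -!map_comp.
apply/eq_in_map => g /H[pg] /=.
rewrite /expsum !big_cons big_nil /= !(mulr1z, mulrN1z, mul1r, mulN1r) addr0.
move=> e; apply/eqP; rewrite -natr_Fp_eq !natrD !mod_cosinesE //; try lia.
have absE (a b : nat) : g%:R ^ (a - b + (b - a))%N%:Z + g%:R ^
  (- (a - b + (b - a))%N%:Z) =
    g%:R ^ (a%:Z - b%:Z) + g%:R ^ (- (a%:Z - b%:Z)) :> 'F_q.
  have [ab|ab] := leqP a b.
    have -> : (a - b + (b - a))%N%:Z = - (a%:Z - b%:Z) by lia.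
    by rewrite opprK addrC.
  by have -> : (a - b + (b - a))%N%:Z = a%:Z - b%:Z by lia.
rewrite !absE eq_sym -subr_eq0 -e !PoszD; apply/eqP; ring.
Qed.
End ModPrime.

Lemma check_levelP (F : numFieldType) (q n : nat) gs (z : F) (x y w : nat) :
  check_level q n gs ->
  (2 * n).-primitive_root z ->
  (2 * x < n)%N -> (2 * y < n)%N -> (2 * w < n)%N -> odd (x + y + w) ->
  expsum (cos_terms (y%:Z + w%:Z) (y%:Z - w%:Z) (x%:Z + 1) (x%:Z - 1)) z = 0 ->
  known_solution n x y w.
Proof.
move=> /and3P[pq /allP pg /allP chk] pz hx hy hw od V0.
have hr u : (2 * u < n)%N -> u \in half_range n.
  by move=> hu; rewrite mem_filter mem_iota hu; lia.
have /allP/(_ w (hr _ hw))/allP := chk y (hr _ hy).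
move/(_ (x, _) (map_f _ (hr _ hx))) => /=;
  rewrite od (mod_sumsE pq hx hy hw) ?eqxx // => g gin.
have pgr := mod_prim_rootP pq (pg g gin).
by split=> //; apply: expsum_prim pz pgr V0.
Qed.

(** * Cosines and roots of unity *)

(** The cosine of a pi / n. *)
Definition cosn (R : realType) (n : nat) (a : int) :
  R := cos (a%:~R * (pi / n%:R)).

Section Link.
Variables (R : realType) (n : nat).
Hypothesis n0 : (0 < n)%N.
Let th : R := pi / n%:R.
Local Open Scope complex_scope.
(** The primitive 2 n-th root of unity exp (i pi / n). *)
Definition zeta : R[i] := cos th +i* sin th.

Lemma zetaX (k : nat) : zeta ^+ k = cos (k%:R * th) +i* sin (k%:R * th).
Proof.
elim: k => [|k IH]; first by rewrite expr0 mul0r cos0 sin0.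
rewrite exprS IH -[k.+1%:R]natr1 mulrDl mul1r cosD sinD /zeta.
by apply/eqP; rewrite eq_complex /=; apply/andP; split; apply/eqP; ring.
Qed.

Lemma zetaV (k : nat) : (zeta ^+ k)^-1 = cos (k%:R * th) -i* sin (k%:R * th).
Proof.
apply: mulr1_eq; rewrite zetaX; apply/eqP; rewrite eq_complex /=.
have := cos2Dsin2 (k%:R * th); move: (cos _) (sin _) => c s e.
by apply/andP; split; apply/eqP; [rewrite -e|]; ring.
Qed.

Lemma zeta_cos (a : int) : zeta ^ a + zeta ^ (- a) = (2 * cosn R n a)%:C.
Proof.
wlog [k ->] : a / exists k : nat, a = k%:Z.
  move=> H; case: (intP a) => [|k|k]; [by apply: (H 0); exists 0%N| |].
    by apply: H; exists k.+1.
  rewrite opprK addrC (H k.+1%:Z) ?opprK; last by exists k.+1.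
  by rewrite /cosn mulNr cosN.
rewrite -invr_expz -exprnP zetaV zetaX /cosn -/th.
by apply/eqP; rewrite eq_complex /=; apply/andP; split; apply/eqP; ring.
Qed.

Lemma zeta_prim : (2 * n).-primitive_root zeta.
Proof.
have nR : n%:R != 0 :> R by rewrite pnatr_eq0 -lt0n.
rewrite /primitive_root_of_unity muln_gt0 n0 /=; apply/forallP => i.
rewrite unity_rootE zetaX eq_complex /=.
have [->|ne] := eqVneq i.+1 (2 * n)%N.
  have -> : (2 * n)%:R * th = pi *+ 2.
    by rewrite /th natrM -mulr_natl; field.
  by rewrite cos2pi sin2pi !eqxx.
rewrite eqbF_neg; apply/negP => /andP[/eqP c1 _].
have h : 0 < i.+1%:R * th / 2 < pi.
  have lt : (i.+1%:R < (2 * n)%:R :> R) by rewrite ltr_nat ltn_neqAle ne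
    ltn_ord.
  have n0R : 0 < n%:R :> R by rewrite ltr0n.
  rewrite /th; apply/andP; split.
    by rewrite !divr_gt0 // mulr_gt0 ?divr_gt0 ?pi_gt0 ?ltr0n.
  rewrite mulrA -mulrA -invfM ltr_pdivrMr ?mulr_gt0 // mulrC ltr_pM2l ?pi_gt0
    //.
  by rewrite [n%:R * _]mulrC -natrM.
have := sin_gt0_pi h; rewrite lt0r => /andP[/negP + _]; apply.
have : cos (i.+1%:R * th / 2 + i.+1%:R * th / 2) = 1 by rewrite -splitr.
rewrite cosD -!expr2 => e; have := cos2Dsin2 (i.+1%:R * th / 2) => e2.
rewrite -sqrf_eq0; apply/eqP; lra.
Qed.

Lemma cosn_prod (a b : int) :
  2 * (cosn R n a * cosn R n b) = cosn R n (a + b) + cosn R n (a - b).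
Proof.
rewrite /cosn -/th.
have -> : (a + b)%:~R * th = a%:~R * th + b%:~R * th by rewrite intrD mulrDl.
have -> : (a - b)%:~R * th = a%:~R * th - b%:~R * th by rewrite intrB mulrBl.
by rewrite cosD cosB; ring.
Qed.

Lemma zeta_expsum (x y w : int) :
  cosn R n 1 * cosn R n x = cosn R n y * cosn R n w ->
  expsum (cos_terms (y + w) (y - w) (x + 1) (x - 1)) zeta = 0.
Proof.
move=> e; rewrite /expsum !big_cons big_nil /= !(mulr1z, mulrN1z, mul1r, mulN1r)
  addr0.
set X := (LHS).
have -> : X = (zeta ^ (y + w) + zeta ^ (- (y + w))) +
  (zeta ^ (y - w) + zeta ^ (- (y - w)))
  - ((zeta ^ (x + 1) + zeta ^ (- (x + 1))) +
    (zeta ^ (x - 1) + zeta ^ (- (x - 1)))).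
  by rewrite /X; ring.
rewrite !zeta_cos -!rmorphD -rmorphB /= -!mulrDr -!cosn_prod
  [cosn R n x * _]mulrC e.
by rewrite subrr.
Qed.
End Link.

(** * Solutions of the cosine equation *)

Lemma small_pairs_exceptional n a b :
  (n, a, b) \in small_pairs -> exceptional n a b.
Proof.
have step (t : nat * nat * nat) (s : seq (nat * nat * nat)) :
    exceptional t.1.1 t.1.2 t.2 -> ((n, a, b) \in s -> exceptional n a b) ->
    (n, a, b) \in t :: s -> exceptional n a b.
  by case: t => [[n' a'] b'] /= H1 H2; rewrite inE => /orP[/eqP[-> -> ->]|].
have fam1 k t : (2 <= k)%N ->
    t \in [:: (6 * k, 2 * k, 3 * k - 1); (6 * k, 3 * k - 2, 3 * k - 1);
              (6 * k, 2 * k, 3 * k - 2)]%N -> exceptional t.1.1 t.1.2 t.2.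
  by case: t => [[n' a'] b']; constructor 1; exists k.
have fam2 k t : (1 <= k)%N ->
    t \in [:: (12 * k + 6, 3 * k + 1, 4 * k + 2);
              (12 * k + 6, 3 * k + 2, 4 * k + 2);
              (12 * k + 6, 3 * k + 1, 3 * k + 2)]%N ->
                exceptional t.1.1 t.1.2 t.2.
  by case: t => [[n' a'] b']; constructor 2; exists k.
rewrite /small_pairs.
repeat (apply: (step _ _); first (first
  [ by constructor 3 | by constructor 4 | by apply: (fam1 2%N) | by apply:
    (fam1 5%N)
  | by apply: (fam1 7%N) | by apply: (fam1 10%N) | by apply:
    (fam2 2%N) | by apply: (fam2 3%N)])).
by [].
Qed.

Lemma trivial_or_family_exceptional n x y w : (6 < n)%N ->
  trivial_or_family n x y w ->
  (y = 1 /\ w = x) \/ (w = 1 /\ y = x) \/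
  forall a b, a \in [:: x; y; w] -> b \in [:: x; y; w] -> (1 < a)%N ->
    (a < b)%N ->
    exceptional n a b.
Proof.
move=> n6 [[[-> ->]|[-> ->]]|[k [nE xE H]]|[k [nE xE H]]];
  [by left|by right; left| |].
  right; right => a b ha hb a1 ab; constructor 1; exists k; first by lia.
  rewrite !inE !xpair_eqE; rewrite !inE in ha hb.
  by case: H => -[yE wE]; case/or3P: ha => /eqP ha; case/or3P: hb => /eqP hb;
    lia.
right; right => a b ha hb a1 ab; constructor 2; exists k; first by lia.
rewrite !inE !xpair_eqE; rewrite !inE in ha hb.
by case: H => -[yE wE]; case/or3P: ha => /eqP ha; case/or3P: hb => /eqP hb; lia.
Qed.

Lemma known_exceptional n x y w : known_solution n x y w ->
  (y = 1 /\ w = x) \/ (w = 1 /\ y = x) \/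
  forall a b, a \in [:: x; y; w] -> b \in [:: x; y; w] -> (1 < a)%N ->
    (a < b)%N ->
    exceptional n a b.
Proof.
case/or3P => [/andP[/eqP -> /eqP ->]|/andP[/eqP -> /eqP ->]|/allP H];
  [by left|by right; left|].
right; right => a b ha hb a1 ab; apply: small_pairs_exceptional.
by have /allP/(_ b hb) := H a ha; rewrite a1 ab.
Qed.

(** The classification of the solutions of c 1 c x = c y c w. *)
Lemma cos_product_relation (R : realType) n (x y w : nat) :
  (6 < n)%N -> (2 * x < n)%N -> (2 * y < n)%N -> (2 * w < n)%N ->
    odd (x + y + w) ->
  cosn R n 1 * cosn R n x%:Z = cosn R n y%:Z * cosn R n w%:Z ->
  (y = 1 /\ w = x)%N \/ (w = 1 /\ y = x)%N \/
  forall a b, a \in [:: x; y; w] -> b \in [:: x; y; w] -> (1 < a)%N ->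
    (a < b)%N ->
    exceptional n a b.
Proof.
move=> n6 hx hy hw od e; have n0 : (0 < n)%N by lia.
have V0 := zeta_expsum e; have pz := zeta_prim R n0.
have n4 : (4 < n)%N by lia.
have [c|d|d] := classify_up_to_60 pz n4 hx hy hw V0.
- exact: trivial_or_family_exceptional.
- apply: known_exceptional; have /allP H := check_levels.
  have : n \in [seq d <- divisors 42 | (6 < d)%N] by rewrite mem_filter n6
    -dvdn_divisors.
  rewrite (_ : [seq d <- divisors 42 | _] = [:: 7; 14; 21; 42]%N) //.
  rewrite !inE => /or4P[]/eqP nE; rewrite nE in pz hx hy hw V0 *.
  + exact: (check_levelP (H (337, 7, [:: 42])%N isT) pz hx hy hw od V0).
  + exact: (check_levelP (H (337, 14, [:: 36])%N isT) pz hx hy hw od V0).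
  + exact: (check_levelP (H (337, 21, [:: 21])%N isT) pz hx hy hw od V0).
  + exact: (check_levelP (H (337, 42, [:: 9; 18])%N isT) pz hx hy hw od V0).
- apply: known_exceptional; have /allP H := check_levels.
  have : n \in [seq d <- divisors 60 | (6 < d)%N] by rewrite mem_filter n6
    -dvdn_divisors.
  rewrite (_ : [seq d <- divisors 60 | _] = [:: 10; 12; 15; 20; 30; 60]%N) //.
  rewrite !inE => /or4P[/eqP nE|/eqP nE|/eqP nE|/or3P[]/eqP nE];
    rewrite nE in pz hx hy hw V0 *.
  + exact: (check_levelP (H (241, 10, [:: 6])%N isT) pz hx hy hw od V0).
  + exact: (check_levelP (H (241, 12, [:: 2])%N isT) pz hx hy hw od V0).
  + exact: (check_levelP (H (241, 15, [:: 10])%N isT) pz hx hy hw od V0).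
  + exact: (check_levelP (H (241, 20, [:: 5])%N isT) pz hx hy hw od V0).
  + exact: (check_levelP (H (241, 30, [:: 9])%N isT) pz hx hy hw od V0).
  + exact: (check_levelP (H (241, 60, [:: 3; 12])%N isT) pz hx hy hw od V0).
Qed.

(** * The exceptional triples are solutions *)

Section CosRelations.
Variables (R : realType).

(** The sum of the cosines of d equally spaced angles vanishes. *)
Lemma cosn_sum (n d : nat) (u : int) : (0 < n)%N -> (1 < d)%N ->
  (d %| 2 * n)%N ->
  \sum_(j < d) cosn R n (u + (j * (2 * n %/ d))%N%:Z) = 0.
Proof.
move=> n0 d1 dN; have pz := zeta_prim R n0; have z0 := prim_root_neq0 pz.
have po := dvdn_prim_root pz dN; set m := (_ %/ _)%N in po *.
have half (a v : int) : a = 1 \/ a = -1 ->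
    \sum_(j < d) zeta R n ^ (a * (v + (j * m)%N%:Z)) = 0.
  move=> ha; have := sum_prim_powers a po; rewrite ifF; last first.
    by case: ha => ->; rewrite dvdzE /= dvdn1; case: (d) d1 => [|[]].
  move=> S; rewrite -[RHS](mulr0 (zeta R n ^ (a * v))) -[in RHS]S big_distrr /=.
  apply: eq_bigr => j _; rewrite exprnP exprz_exp -expfzDr //; congr (_ ^ _).
  by rewrite PoszM; ring.
have /eqP : 2 * \sum_(j < d) cosn R n (u + (j * m)%N%:Z) = 0.
  have h := half 1 u (or_introl erefl);
    have h' := half (-1) u (or_intror erefl).
  apply: (@complexI R); rewrite big_distrr rmorph_sum /= rmorph0.
  transitivity (\sum_(j < d) zeta R n ^ (1 * (u + (j * m)%N%:Z)) +
                \sum_(j < d) zeta R n ^ (-1 * (u + (j * m)%N%:Z)));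
                  last by rewrite h h' addr0.
  by rewrite -big_split /=; apply: eq_bigr => j _;
    rewrite -zeta_cos // mul1r mulN1r.
by rewrite mulf_eq0 pnatr_eq0 /= => /eqP.
Qed.

Lemma cosnN n (a : int) : cosn R n (- a) = cosn R n a.
Proof. by rewrite /cosn rmorphN /= mulNr cosN. Qed.

Lemma cosn0 n : cosn R n 0 = 1.
Proof. by rewrite /cosn mul0r cos0. Qed.

Lemma cosn_half n (a : int) : (0 < n)%N -> cosn R n (n%:Z - a) = - cosn R n a.
Proof.
move=> n0; have nR : n%:R != 0 :> R by rewrite pnatr_eq0 -lt0n.
rewrite /cosn; have -> : (n%:Z - a)%:~R * (pi / n%:R) = - (a%:~R * (pi / n%:R))
  + pi :> R.
  by rewrite intrB /=; field.
by rewrite cosDpi cosN.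
Qed.

Lemma cosn_full n (a : int) : (0 < n)%N ->
  cosn R n ((2 * n)%N%:Z - a) = cosn R n a.
Proof.
move=> n0; have -> : (2 * n)%N%:Z - a = n%:Z - (- (n%:Z - a)) by lia.
by rewrite cosn_half // cosnN cosn_half // opprK.
Qed.

Lemma cosn_third (k : nat) (a : int) : (0 < k)%N ->
  cosn R (3 * k) (a + k%:Z) + cosn R (3 * k) (a - k%:Z) = cosn R (3 * k) a.
Proof.
move=> k0; have n0 : (0 < 3 * k)%N by lia.
have := @cosn_sum (3 * k) 3 a n0 isT.
rewrite mulnCA dvdn_mulr // => /(_ isT).
rewrite mulKn // !big_ord_recl big_ord0 /= addr0.
rewrite /bump /= ?mul0n ?addr0 ?mul1n.
have -> : a + (2 * k)%N%:Z = (3 * k)%N%:Z - - (a - k%:Z) by lia.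
have -> : a + ((1 + 1) * (2 * k))%N%:Z = (2 * (3 * k))%N%:Z -
  ((3 * k)%N%:Z - - - (a + k%:Z)) by lia.
rewrite cosn_full // !cosn_half // !cosnN.
by move=> e; lra.
Qed.

Lemma cosn_quarter (k : nat) : (0 < k)%N -> cosn R (2 * k) k%:Z = 0.
Proof.
move=> k0; have := @cosn_half (2 * k) k%:Z; rewrite muln_gt0 k0 => /(_ isT).
have -> : (2 * k)%N%:Z - k%:Z = k%:Z by lia.
lra.
Qed.

(** The equation c 1 c x = c y c w. *)
Definition cos_rel (n x y w : nat) : Prop :=
  cosn R n 1 * cosn R n x%:Z = cosn R n y%:Z * cosn R n w%:Z.

Lemma cos_relE n x y w :
  cosn R n (x%:Z + 1) + cosn R n (x%:Z - 1) = cosn R n (y%:Z + w%:Z) + cosn R n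
    (y%:Z - w%:Z) ->
  cos_rel n x y w.
Proof.
move=> e; apply: (@mulfI R 2); first by rewrite pnatr_eq0.
by rewrite [RHS]cosn_prod -e -cosn_prod [cosn R n 1 * _]mulrC.
Qed.

(** This is the duplication formula for the sine of pi / n. *)
Lemma cos_rel_family1 k : (1 < k)%N ->
  cos_rel (6 * k) (3 * k - 1) (2 * k) (3 * k - 2).
Proof.
move=> k1; apply: cos_relE.
have -> : (3 * k - 1)%N%:Z + 1 = (3 * k)%N by lia.
have -> : (3 * k - 1)%N%:Z - 1 = (3 * k - 2)%N%:Z by lia.
have -> : (6 * k = 2 * (3 * k))%N by lia.
rewrite cosn_quarter ?add0r; last by lia.
have -> : (2 * (3 * k) = 3 * (2 * k))%N by lia.
rewrite -(@cosn_third (2 * k) (3 * k - 2)%N%:Z); last by lia.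
by rewrite -[cosn R _ (_ - (2 * k)%N%:Z)]cosnN opprB
  [(3 * k - 2)%N%:Z + _]addrC.
Qed.

Lemma cos_rel_family2 k : cos_rel (12 * k + 6) (4 * k + 2) (3 * k + 1)
  (3 * k + 2).
Proof.
apply: cos_relE.
have -> : (3 * k + 1)%N%:Z + (3 * k + 2)%N%:Z = (6 * k + 3)%N by lia.
have -> : (3 * k + 1)%N%:Z - (3 * k + 2)%N%:Z = - 1 by lia.
have -> : (12 * k + 6 = 2 * (6 * k + 3))%N by lia.
rewrite cosn_quarter ?add0r; last by lia.
have -> : (2 * (6 * k + 3) = 3 * (4 * k + 2))%N by lia.
rewrite cosnN -(@cosn_third (4 * k + 2) 1); last by lia.
by rewrite -[cosn R _ (1 - (4 * k + 2)%N%:Z)]cosnN opprB [1 + _]addrC.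
Qed.

(** After the addition formulas, each relation is a linear combination of
    vanishing sums of 3 and 5, or 3 and 7, equally spaced cosines. *)
Lemma cos_rel_sporadic :
  [/\ cos_rel 30 7 4 6, cos_rel 30 11 6 10, cos_rel 30 13 8 12 & cos_rel 42 13 6
    12].
Proof.
pose c (i : int) := cosn R 30 i.
have c0 : c 0 = 1 by exact: cosn0.
(* Vanishing sums for n = 30, folded to indices between 0 and 15. *)
have t0 : c 10 + c (-10) = c 0 := @cosn_third 10 0 isT.
have t2 : c 12 + c (-8) = c 2 := @cosn_third 10 2 isT.
have t4 : c 14 + c (-6) = c 4 := @cosn_third 10 4 isT.
have N10 : c (-10) = c 10 := cosnN 30 10.
have N8 : c (-8) = c 8 := cosnN 30 8.
have N6 : c (-6) = c 6 := cosnN 30 6.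
have f0 := @cosn_sum 30 5 0 isT isT isT.
have f2 := @cosn_sum 30 5 2 isT isT isT.
have H (u : int) : \sum_(j < 5) cosn R 30 (u + (j * (2 * 30 %/ 5))%N%:Z) =
  c u + c (u + 12) + c (u + 24) + c (u + 36) + c (u + 48).
  by rewrite !big_ord_recl big_ord0 /= !addrA !addr0.
rewrite !H {H} in f0 f2.
have h24 : c (0 + 24) = - c 6 := @cosn_half 30 6 isT.
have h36 : c (0 + 36) = c 24 := @cosn_full 30 24 isT.
have h24' : c 24 = - c 6 := @cosn_half 30 6 isT.
have h48 : c (0 + 48) = c 12 := @cosn_full 30 12 isT.
have h26 : c (2 + 24) = - c 4 := @cosn_half 30 4 isT.
have h38 : c (2 + 36) = c 22 := @cosn_full 30 22 isT.
have h22 : c 22 = - c 8 := @cosn_half 30 8 isT.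
have h50 : c (2 + 48) = c 10 := @cosn_full 30 10 isT.
have a12 : c (0 + 12) = c 12 by [].
have a14 : c (2 + 12) = c 14 by [].
have h16 : c 16 = - c 14 := @cosn_half 30 14 isT.
have h20 : c 20 = - c 10 := @cosn_half 30 10 isT.
have N4 : c (-4) = c 4 := cosnN 30 4.
have N2 : c (-2) = c 2 := cosnN 30 2.
(* The same for n = 42. *)
pose d (i : int) := cosn R 42 i.
have d0 : d 0 = 1 by exact: cosn0.
have s0 : d 14 + d (-14) = d 0 := @cosn_third 14 0 isT.
have M14 : d (-14) = d 14 := cosnN 42 14.
have M6 : d (-6) = d 6 := cosnN 42 6.
have g0 : d 0 + d 12 + d 24 + d 36 + d 48 + d 60 + d 72 = 0.
  rewrite -(@cosn_sum 42 7 0 isT isT isT).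
  by rewrite !big_ord_recl big_ord0 /= !addrA !addr0.
have k24 : d 24 = - d 18 := @cosn_half 42 18 isT.
have k36 : d 36 = - d 6 := @cosn_half 42 6 isT.
have k48 : d 48 = d 36 := @cosn_full 42 36 isT.
have k60 : d 60 = d 24 := @cosn_full 42 24 isT.
have k72 : d 72 = d 12 := @cosn_full 42 12 isT.
split; apply: cos_relE.
- change (c 8 + c 6 = c 10 + c (-2)); lra.
- change (c 12 + c 10 = c 16 + c (-4)); lra.
- change (c 14 + c 12 = c 20 + c (-4)); lra.
- change (d 14 + d 12 = d 18 + d (-6)); lra.
Qed.

Lemma exceptional_relation n l m : exceptional n l m -> exists s : nat,
  odd (l + m + s) /\ [\/ cos_rel n s l m, cos_rel n m l s | cos_rel n l m s].
Proof.
have main x y w : cos_rel n x y w -> odd (x + y + w) ->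
    (l, m) \in [:: (x, y); (y, x); (x, w); (w, x); (y, w); (w, y)] ->
    exists s : nat, odd (l + m + s) /\
      [\/ cos_rel n s l m, cos_rel n m l s | cos_rel n l m s].
  move=> e od; have e' : cos_rel n x w y by rewrite /cos_rel mulrC [RHS]mulrC -e
    mulrC.
  rewrite !inE => /or4P[|||/or3P[]] /eqP[-> ->];
    [exists w|exists w|exists y|exists y|exists x|exists x];
    (split; first by lia); by [constructor 1|constructor 2|constructor 3].
have [s1 s2 s3 s4] := cos_rel_sporadic.
case=> [[k k2]|[k k1]| |].
- rewrite !inE => H; have nE : n = (6 * k)%N by case/or3P: H => /eqP[].
  have r := cos_rel_family1 k2; rewrite -nE in r.
  apply: (main _ _ _ r); first by lia.
  by rewrite !inE; case/or3P: H => /eqP[_ -> ->]; rewrite ?eqxx ?orbT.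
- rewrite !inE => H; have nE : n = (12 * k + 6)%N by case/or3P: H => /eqP[].
  have r := cos_rel_family2 k; rewrite -nE in r.
  apply: (main _ _ _ r); first by lia.
  by rewrite !inE; case/or3P: H => /eqP[_ -> ->]; rewrite ?eqxx ?orbT.
- rewrite !inE => H.
  have nE : n = 30%N by move: H; do !case/orP; case/eqP.
  rewrite -nE in s1 s2 s3.
  have [h|/orP[h|h]] : (l, m) \in [:: (4, 6); (4, 7); (6, 7)]%N \/
     ((l, m) \in [:: (6, 10); (6, 11); (10, 11)]%N) ||
       ((l, m) \in [:: (8, 12); (8, 13); (12, 13)]%N).
    move: H; do !case/orP; case/eqP => _ -> ->;
      first [by left | by right].
  + by apply: (main _ _ _ s1) => //; move: h; rewrite !inE =>
    /or3P[]/eqP[-> ->].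
  + by apply: (main _ _ _ s2) => //; move: h; rewrite !inE =>
    /or3P[]/eqP[-> ->].
  + by apply: (main _ _ _ s3) => //; move: h; rewrite !inE =>
    /or3P[]/eqP[-> ->].
- rewrite !inE => H.
  have nE : n = 42%N by move: H; do !case/orP; case/eqP.
  rewrite -nE in s4.
  apply: (main _ _ _ s4) => //; move: H; rewrite !inE.
  by do !case/orP; case/eqP => _ -> ->.
Qed.
End CosRelations.

(** * Non-exceptional pairs have no solution *)

Section NoRelation.
Variables (R : realType) (n : nat).
Hypothesis n0 : (0 < n)%N.
Local Notation c := (cosn R n).

Lemma cosn_eqP (a b : int) : c a = c b <-> (2 * n %| a - b)%Z \/
  (2 * n %| a + b)%Z.
Proof.
have pz := zeta_prim R n0; have z0 := prim_root_neq0 pz.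
split=> [e|].
  by apply: (cosz_eq pz); rewrite !zeta_cos // e.
move=> H; have h : zeta R n ^ a + zeta R n ^ (- a) = zeta R n ^ b + zeta R n ^
  (- b).
  have e1 (u v : int) : (2 * n %| u - v)%Z -> zeta R n ^ u = zeta R n ^ v.
    rewrite -(prim_exprz_eq1 _ pz) => /eqP e;
      apply/(mulIf (expfz_neq0 (- v) z0)).
    by rewrite -!expfzDr // e subrr expr0z.
  case: H => [h|h]; first by rewrite -invr_expz -[zeta R n ^ (- b)]invr_expz
    (e1 _ _ h).
  rewrite (e1 a (- b)) ?opprK // (e1 (- a) b) 1?addrC //.
  by rewrite -dvdz_opp; congr (_ %| _)%Z: h; ring.
move: h; rewrite !zeta_cos // => /complexI; apply: mulfI; by rewrite pnatr_eq0.
Qed.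

Lemma cosn_gt0 (u : nat) : (2 * u < n)%N -> 0 < c u%:Z.
Proof.
move=> hu; apply: cos_gt0_pihalf.
have nR : 0 < n%:R :> R by rewrite ltr0n.
have t0 : 0 <= u%:~R * (pi / n%:R) :> R.
  by rewrite mulr_ge0 ?ler0z // divr_ge0 ?pi_ge0 ?ler0n.
apply/andP; split.
  by apply: lt_le_trans t0; rewrite oppr_lt0 divr_gt0 ?pi_gt0.
rewrite mulrCA ltr_pM2l ?pi_gt0 // ltr_pdivrMr // mulrC ltr_pdivlMr //.
by rewrite -natrM ltr_nat mulnC.
Qed.

(** One of the residues of s and - s modulo 2 n lies between 0 and n, and both
    have the parity of s. *)
Lemma cosn_reduce (s : int) : 0 < c s ->
  exists u : nat, [/\ (2 * u < n)%N, c u%:Z = c s & (2 %| u%:Z - s)%Z].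
Proof.
move=> s0; have N0 : (2 * n)%N%:Z != 0 by lia.
have r0 := modz_ge0 s N0; have rN := ltz_pmod s (_ : 0 < (2 * n)%N%:Z).
have {}rN : (s %% (2 * n)%N)%Z < (2 * n)%N%:Z by apply: rN; lia.
have sE := divz_eq s (2 * n)%N%:Z.
set q := (s %/ _)%Z in sE; set r := (s %% _)%Z in sE r0 rN.
pose u : nat := if r <= n%:Z then `|r|%N else (2 * n - `|r|)%N.
have un : (u <= n)%N by rewrite /u; case: ifP; lia.
have cu : c u%:Z = c s.
  apply/cosn_eqP; rewrite /u; case: ifP => _.
    left; apply/dvdzP; exists (- q); rewrite {1}sE; lia.
  right; apply/dvdzP; exists (1 + q); rewrite {1}sE; lia.
have pu : (2 %| u%:Z - s)%Z.
  have [v ->] : exists v, s = r + 2 * v.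
    by exists (q * n%:Z); rewrite {1}sE PoszM; ring.
  by rewrite /u; case: ifP; lia.
exists u; split=> //; rewrite ltnNge; apply/negP => h.
have := s0; rewrite -cu ltNge => /negP; apply.
have -> : u%:Z = n%:Z - (n - u)%N%:Z by lia.
rewrite cosn_half // oppr_le0; have [e|lt] := eqVneq (2 * u)%N n.
  have -> : (n - u = u)%N by lia.
  by rewrite -{1}e cosn_quarter //; lia.
by rewrite ltW // cosn_gt0 //; lia.
Qed.

(** In each of the three equations s reduces to a natural number u below n / 2.
    A trivial solution is excluded since the three given indices are 1, l, m
    with 1 < l < m, so that l and m are two entries of a non-trivial one. *)
Lemma no_relation (l m : nat) (s : int) : (6 < n)%N -> (1 < l)%N -> (l < m)%N ->
  (2 * m < n)%N -> ~ exceptional n l m -> ~~ (2 %| l%:Z + m%:Z + s)%Z ->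
  [/\ c 1 * c s <> c l%:Z * c m%:Z, c l%:Z * c s <> c 1 * c m%:Z &
      c m%:Z * c s <> c 1 * c l%:Z].
Proof.
move=> n6 l1 lm mn nex od.
have c1 : 0 < c 1 by apply: (@cosn_gt0 1); lia.
have cl : 0 < c l%:Z by apply: cosn_gt0; lia.
have cm : 0 < c m%:Z by apply: cosn_gt0; lia.
have red (a b d : R) : 0 < a -> 0 < b -> 0 < d -> a * c s = b * d ->
    exists u : nat, [/\ (2 * u < n)%N, a * c u%:Z = b * d & odd (l + m + u)].
  move=> a0 b0 d0 e; have : 0 < a * c s by rewrite e mulr_gt0.
  rewrite pmulr_rgt0 // => /cosn_reduce[u [hu cu pu]]; exists u; split=> //.
    by rewrite cu.
  by move: od pu; clear; lia.
have key x y w : (2 * x < n)%N -> (2 * y < n)%N -> (2 * w < n)%N ->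
  odd (x + y + w) ->
    c 1 * c x%:Z = c y%:Z * c w%:Z ->
      ~ ((y = 1 /\ w = x)%N \/ (w = 1 /\ y = x)%N) ->
    l \in [:: x; y; w] -> m \in [:: x; y; w] -> False.
  move=> hx hy hw o e nt hl hm.
  case: (cos_product_relation n6 hx hy hw o e) => [h|[h|h]].
  - by apply: nt; left.
  - by apply: nt; right.
  - exact: nex (h l m hl hm l1 lm).
split.
- move=> /(red _ _ _ c1 cl cm)[u [hu e o]].
  apply: (key u l m) => //; try lia; rewrite !inE ?eqxx ?orbT //; lia.
- move=> /(red _ _ _ cl c1 cm)[u [hu e o]].
  apply: (key m l u) => //; try lia; rewrite ?inE ?eqxx ?orbT //; lia.
- move=> /(red _ _ _ cm c1 cl)[u [hu e o]].
  apply: (key l m u) => //; try lia; rewrite ?inE ?eqxx ?orbT //; lia.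
Qed.

End NoRelation.

(** * Points and lines in polar form *)

Local Open Scope classical_set_scope.
Local Open Scope card_scope.

Lemma card_uniq_seq (T : eqType) (s : seq T) : uniq s ->
  [set x | x \in s] #= `I_(size s).
Proof.
case: s => [|x0 s0] us.
  rewrite (_ : [set x | x \in [::]] = set0) ?II0 ?card_eqxx //.
  by apply/seteqP; split=> x.
set s := x0 :: s0 in us *.
have -> : [set x | x \in s] = [set nth x0 s i | i in `I_(size s)].
  apply/seteqP; split=> [x /= /(nthP x0)[i lt_i <-]|_ [i lt_i <-]];
    first by exists i.
  exact: mem_nth.
by apply: inj_card_eq => i j; rewrite !inE => /= hi hj /eqP;
  rewrite nth_uniq // => /eqP.
Qed.

Lemma card_range_fin (T : finType) (U : eqType) (f : T -> U) :
  injective f -> range f #= `I_#|T|.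
Proof.
move=> injf; rewrite -(size_codom f).
have -> : range f = [set x | x \in codom f].
  apply/seteqP; split=> [_ [i _ <-]|x /codomP[i ->]]; first exact: codom_f.
  by exists i.
by apply: card_uniq_seq; apply/injectiveP.
Qed.

Section Geometry.
Variables (R : realType) (n : nat).
Hypothesis n2 : (2 < n)%N.
Variables (ctr : R * R) (th : R) (sg : bool).
Local Notation c := (cosn R n).
Let n0 : (0 < n)%N. Proof. exact: ltn_trans n2. Qed.

(** The direction u pi / n, counted from th in the sense given by sg. *)
Definition ang (u : int) : R := th + (-1) ^+ sg * (u%:~R * (pi / n%:R)).
(** The point at distance rho from ctr in the direction [ang u]. *)
Definition polar_point (rho : R) (u : int) : R * R :=
  (ctr.1 + rho * cos (ang u), ctr.2 + rho * sin (ang u)).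
(** The coordinates of p - ctr in the direct orthonormal frame whose first
    vector has the direction [ang v]. *)
Definition normal_coord (v : int) (p : R * R) : R :=
  (p.1 - ctr.1) * cos (ang v) + (p.2 - ctr.2) * sin (ang v).
Definition tangent_coord (v : int) (p : R * R) : R :=
  (p.2 - ctr.2) * cos (ang v) - (p.1 - ctr.1) * sin (ang v).
(** The line at distance delta from ctr with normal direction [ang v]. *)
Definition polar_line (delta : R) (v : int) :
  set (R * R) := [set p | normal_coord v p = delta].
(** The sine of a pi / n, with the sign given by the orientation. *)
Definition sinn (a : int) : R := (-1) ^+ sg * sin (a%:~R * (pi / n%:R)).

Lemma ang_sub u v : ang u - ang v = (-1) ^+ sg * ((u - v)%:~R * (pi / n%:R)).
Proof. by rewrite /ang intrB; ring. Qed.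

Lemma cos_ang_sub u v : cos (ang u - ang v) = c (u - v).
Proof. by rewrite ang_sub /cosn; case: sg; rewrite ?mul1r // mulN1r cosN. Qed.

Lemma sin_ang_sub u v : sin (ang u - ang v) = sinn (u - v).
Proof. by rewrite ang_sub /sinn; case: sg;
  rewrite /= ?mul1r // !mulN1r sinN. Qed.

Lemma normal_coord_polar rho u v : normal_coord v (polar_point rho u) = rho * c
  (u - v).
Proof. by rewrite -cos_ang_sub cosB /normal_coord /=; ring. Qed.

Lemma tangent_coord_polar rho u v : tangent_coord v (polar_point rho u) = rho *
  sinn (u - v).
Proof. by rewrite -sin_ang_sub sinB /tangent_coord /=; ring. Qed.

Lemma point_eq v p q : normal_coord v p = normal_coord v q ->
  tangent_coord v p = tangent_coord v q -> p = q.
Proof.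
rewrite /normal_coord /tangent_coord; have := cos2Dsin2 (ang v).
case: p q => [p1 p2] [q1 q2] /=; move: (cos _) (sin _) => C S e e1 e2.
have h1 : p1 - q1 = 0.
  rewrite -[LHS]mul1r -e.
  transitivity (C * (((p1 - ctr.1) * C + (p2 - ctr.2) * S) -
    ((q1 - ctr.1) * C + (q2 - ctr.2) * S))
   - S * (((p2 - ctr.2) * C - (p1 - ctr.1) * S) -
     ((q2 - ctr.2) * C - (q1 - ctr.1) * S))); first by ring.
  by rewrite e1 e2; ring.
have h2 : p2 - q2 = 0.
  rewrite -[LHS]mul1r -e.
  transitivity (S * (((p1 - ctr.1) * C + (p2 - ctr.2) * S) -
    ((q1 - ctr.1) * C + (q2 - ctr.2) * S))
   + C * (((p2 - ctr.2) * C - (p1 - ctr.1) * S) -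
     ((q2 - ctr.2) * C - (q1 - ctr.1) * S))); first by ring.
  by rewrite e1 e2; ring.
by congr (_, _); apply/eqP; rewrite -subr_eq0 ?h1 ?h2.
Qed.

Lemma cosn2Dsinn2 a : c a ^+ 2 + sinn a ^+ 2 = 1.
Proof.
rewrite /sinn exprMn -exprM mulnC exprM sqrrN expr1n expr1n mul1r.
exact: cos2Dsin2.
Qed.

Lemma sinnN a : sinn (- a) = - sinn a.
Proof. by rewrite /sinn rmorphN /= mulNr sinN mulrN. Qed.

Lemma sinn_neq0 (k : nat) : (0 < k < n)%N -> sinn k%:Z != 0.
Proof.
move=> /andP[k0 kn]; rewrite /sinn mulf_neq0 ?signr_eq0 //.
rewrite gt_eqF // sin_gt0_pi //.
have nR : 0 < n%:R :> R by rewrite ltr0n.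
rewrite mulr_gt0 ?divr_gt0 ?pi_gt0 ?ltr0z //= mulrCA gtr_pMr ?pi_gt0 //.
by rewrite ltr_pdivrMr // mul1r ltr_nat.
Qed.

Lemma cosn_eq1 a : c a = 1 <-> (2 * n %| a)%Z.
Proof.
split=> [e|d].
  have /(cosn_eqP R n0)[] : c a = c 0 by rewrite cosn0.
    by rewrite subr0.
  by rewrite addr0.
rewrite -(cosn0 R n); apply/(cosn_eqP R n0); left.
by rewrite subr0.
Qed.

Lemma polar_point_periodic rho u v : (2 * n %| u - v)%Z ->
  polar_point rho u = polar_point rho v.
Proof.
move=> /cosn_eq1 e; have := cosn2Dsinn2 (u - v); rewrite e => s0.
have {}s0 : sinn (u - v) = 0 by apply/eqP; rewrite -sqrf_eq0; apply/eqP; lra.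
have c00 := cosn0 R n; have s00 : sinn 0 = 0 by rewrite /sinn mul0r sin0 mulr0.
apply: (@point_eq v); rewrite ?normal_coord_polar ?tangent_coord_polar subrr.
  by rewrite e c00.
by rewrite s0 s00.
Qed.

Lemma polar_point_inj rho rho' u v : 0 < rho -> 0 < rho' ->
  polar_point rho u = polar_point rho' v ->
  rho = rho' /\ (2 * n %| u - v)%Z.
Proof.
move=> r0 r0' e.
have h1 : rho * c (u - v) = rho'.
  by rewrite -normal_coord_polar e normal_coord_polar subrr cosn0 mulr1.
have h2 : rho' * c (u - v) = rho.
  by rewrite -(cosnN R n) opprB -normal_coord_polar -e normal_coord_polar subrr
    cosn0 mulr1.
have h3 : c (u - v) = 1.
  have cp : 0 < c (u - v) by rewrite -(pmulr_rgt0 _ r0) h1.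
  have : c (u - v) ^+ 2 = 1.
    by apply: (mulfI (lt0r_neq0 r0)); rewrite expr2 mulrA h1 h2 mulr1.
  by move/eqP; rewrite sqrf_eq1 => /orP[/eqP //|/eqP e']; move: cp; rewrite e';
    lra.
by split; [rewrite -h1 h3 mulr1|apply/cosn_eq1].
Qed.

Lemma in_polar_line rho delta u v : polar_line delta v (polar_point rho u) <->
  rho * c (u - v) = delta.
Proof. by rewrite /polar_line /= normal_coord_polar. Qed.

Lemma polar_line_periodic delta u v : (2 * n %| u - v)%Z ->
  polar_line delta u = polar_line delta v.
Proof.
move=> /(polar_point_periodic 1)[]; rewrite !mul1r => /addrI e1 /addrI e2.
by rewrite /polar_line /normal_coord e1 e2.
Qed.

Lemma polar_line_inj delta delta' u v : 0 < delta -> 0 < delta' ->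
  polar_line delta u = polar_line delta' v ->
  delta = delta' /\ (2 * n %| u - v)%Z.
Proof.
move=> d0 d0' e.
have h1 : delta * c (u - v) = delta'.
  by apply/in_polar_line; rewrite -e; apply/in_polar_line;
    rewrite subrr cosn0 mulr1.
have h2 : delta' * c (u - v) = delta.
  rewrite -(cosnN R n) opprB.
  by apply/in_polar_line; rewrite e; apply/in_polar_line;
    rewrite subrr cosn0 mulr1.
have h3 : c (u - v) = 1.
  have cp : 0 < c (u - v) by rewrite -(pmulr_rgt0 _ d0) h1.
  have : c (u - v) ^+ 2 = 1.
    by apply: (mulfI (lt0r_neq0 d0)); rewrite expr2 mulrA h1 h2 mulr1.
  by move/eqP; rewrite sqrf_eq1 => /orP[/eqP //|/eqP e']; move: cp; rewrite e';
    lra.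
by split; [rewrite -h1 h3 mulr1|apply/cosn_eq1].
Qed.

Lemma normal_coord_line v (P Q : R * R) t :
  normal_coord v (P + t *: (Q - P)) = normal_coord v P + t *
    (normal_coord v Q - normal_coord v P).
Proof. by case: P Q => [p1 p2] [q1 q2];
  rewrite /normal_coord /= /GRing.scale /=; ring. Qed.

Lemma tangent_coord_line v (P Q : R * R) t :
  tangent_coord v (P + t *: (Q - P)) = tangent_coord v P + t *
    (tangent_coord v Q - tangent_coord v P).
Proof. by case: P Q => [p1 p2] [q1 q2];
  rewrite /tangent_coord /= /GRing.scale /=; ring. Qed.

(** The points at distance rho in the directions w - k and w + k are symmetric
    with respect to the direction w. *)
Lemma line_polar_points rho (w : int) (k : nat) : 0 < rho -> (0 < k < n)%N ->
  line (polar_point rho (w - k%:Z)) (polar_point rho (w + k%:Z)) = polar_line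
    (rho * c k%:Z) w.
Proof.
move=> r0 kn; have s0 := sinn_neq0 kn; have r1 := lt0r_neq0 r0.
set P := polar_point _ _; set Q := polar_point _ _.
have hP : normal_coord w P = rho * c k%:Z by rewrite normal_coord_polar addrAC
  subrr add0r cosnN.
have hQ : normal_coord w Q = rho * c k%:Z by rewrite normal_coord_polar addrAC
  subrr add0r.
have wP : tangent_coord w P = - (rho * sinn k%:Z) by rewrite tangent_coord_polar
  addrAC subrr add0r sinnN mulrN.
have wQ : tangent_coord w Q = rho * sinn k%:Z by rewrite tangent_coord_polar
  addrAC subrr add0r.
have hL t : normal_coord w (P + t *: (Q - P)) = normal_coord w P + t *
  (normal_coord w Q - normal_coord w P).
  exact: normal_coord_line.
have wL t : tangent_coord w (P + t *: (Q - P)) = tangent_coord w P + t *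
  (tangent_coord w Q - tangent_coord w P).
  exact: tangent_coord_line.
apply/seteqP; split=> [_ [t _ <-]|p hp] /=;
  first by rewrite /polar_line /= hL hP hQ subrr mulr0 addr0.
exists ((tangent_coord w p / (rho * sinn k%:Z) + 1) / 2) => //.
apply: (@point_eq w); first by rewrite hL hP hQ subrr mulr0 addr0 hp.
by rewrite wL wP wQ; field; rewrite s0 r1.
Qed.

(** Applied to consecutive diagonals, this gives the vertices of the k-th
    n-gon. *)
Lemma polar_line_meet delta (w : int) :
  polar_line delta (w - 1) `&` polar_line delta (w + 1) =
    [set polar_point (delta / c 1) w].
Proof.
have c1 : c 1 != 0.
  by rewrite gt_eqF // (@cosn_gt0 R n n0 1).
have s1 : sinn 1 != 0 by apply: (@sinn_neq0 1); rewrite (ltn_trans _ n2).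
apply/seteqP; split=> [p [h1 h2]|_ ->]; last first.
  by split; apply/in_polar_line; rewrite opprD addrA subrr add0r ?opprK ?cosnN;
    field.
have hv (e : int) : normal_coord (w + e) p = normal_coord w p * c e +
  tangent_coord w p * sinn e.
  have -> : c e = cos (ang (w + e) - ang w) by rewrite cos_ang_sub addrAC subrr
    add0r.
  have -> : sinn e = sin (ang (w + e) - ang w) by rewrite sin_ang_sub addrAC
    subrr add0r.
  rewrite cosB sinB /normal_coord /tangent_coord; have := cos2Dsin2 (ang w).
  move: (cos (ang w)) (sin (ang w)) (cos (ang (w + e))) (sin (ang (w + e)))
    (p.1 - _) (p.2 - _) => C S C' S' a b e1.
  by transitivity ((C ^+ 2 + S ^+ 2) * (a * C' + b * S'));
    [rewrite e1 mul1r|ring].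
move: h1 h2; rewrite /polar_line /= !hv cosnN sinnN mulrN => h1 h2.
have g0 : tangent_coord w p = 0 by apply/eqP; rewrite -(mulIr_eq0 _ (mulIf s1));
  apply/eqP; lra.
apply: (@point_eq w); rewrite ?normal_coord_polar ?tangent_coord_polar subrr.
  by rewrite cosn0 mulr1 -h2 g0; field.
by rewrite g0 /sinn mul0r sin0 !mulr0.
Qed.

End Geometry.

(** * The three classes of points and lines *)

Section Counting.
Variables (R : realType) (n : nat).
Hypothesis n2 : (2 < n)%N.
Variables (ctr : R * R) (th : R) (sg : bool) (R0 : R).
Hypothesis R00 : 0 < R0.
Local Notation c := (cosn R n).
Local Notation polar_point := (polar_point n ctr th sg).
Local Notation polar_line := (polar_line n ctr th sg).
Let n0 : (0 < n)%N. Proof. exact: ltn_trans n2. Qed.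

(** The vertices of the k-th n-gon; R0 is r / c 1 for circumradius r. *)
Definition vertices (k : nat) : set (R * R) :=
  range (fun j : int => polar_point (R0 * c k%:Z) (2 * j + k%:Z - 1)).
(** The b-th diagonals of the a-th n-gon, which are also the a-th diagonals of
    the b-th n-gon. *)
Definition common_diagonals (a b : nat) : set (set (R * R)) :=
  range (fun j : int => polar_line (R0 * (c a%:Z * c b%:Z))
    (2 * j + a%:Z + b%:Z - 1)).

Lemma common_diagonalsC a b : common_diagonals a b = common_diagonals b a.
Proof. by rewrite /common_diagonals mulrC; congr (image _ _); apply/funext => j;
  congr (polar_line _ _); ring. Qed.

Lemma verticesP k p : vertices k p <->
  exists2 u : int, (2 %| u - k%:Z + 1)%Z & p = polar_point (R0 * c k%:Z) u.
Proof.
split=> [[j _ <-]|[u hu ->]].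
  by exists (2 * j + k%:Z - 1) => //; lia.
exists ((u - k%:Z + 1) %/ 2)%Z => //; congr (polar_point _ _); lia.
Qed.

Lemma common_diagonalsP a b x : common_diagonals a b x <->
  exists2 v : int, (2 %| v - a%:Z - b%:Z + 1)%Z & x = polar_line
    (R0 * (c a%:Z * c b%:Z)) v.
Proof.
split=> [[j _ <-]|[u hu ->]].
  by exists (2 * j + a%:Z + b%:Z - 1) => //; lia.
exists ((u - a%:Z - b%:Z + 1) %/ 2)%Z => //; congr (polar_line _ _); lia.
Qed.

(** The three classes are treated symmetrically: K(n; l, m) is the structure of
    the triple (1, l, m), or of any of its permutations. *)
Definition triple_points a b d := vertices a `|` vertices b `|` vertices d.
Definition triple_lines a b d := common_diagonals a b `|` common_diagonals a d
  `|` common_diagonals b d.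

Section Triple.
Variables (a b d : nat).
Hypotheses (ha : (0 < 2 * a < n)%N) (hb : (0 < 2 * b < n)%N)
  (hd : (0 < 2 * d < n)%N).
Hypotheses (bd : b <> d).

Let ca : 0 < c a%:Z. Proof. by apply: cosn_gt0 => //; lia. Qed.
Let cb : 0 < c b%:Z. Proof. by apply: cosn_gt0 => //; lia. Qed.
Let cd : 0 < c d%:Z. Proof. by apply: cosn_gt0 => //; lia. Qed.

Let nbd : c b%:Z <> c d%:Z.
Proof. by move=> /(cosn_eqP R n0)[] /dvdz_small; lia. Qed.

(** No vertex of class a lies on a line of class {b, d}. *)
Definition no_extra_incidence : Prop := forall s : int,
  (2 %| a%:Z + b%:Z + d%:Z + s)%Z -> c a%:Z * c s <> c b%:Z * c d%:Z.

Lemma lines_through (u : int) : no_extra_incidence -> (2 %| u - a%:Z + 1)%Z ->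
  [set x | triple_lines a b d x /\ x (polar_point (R0 * c a%:Z) u)] =
  [set x | x \in [:: polar_line (R0 * (c a%:Z * c b%:Z)) (u - b%:Z);
                     polar_line (R0 * (c a%:Z * c b%:Z)) (u + b%:Z);
                     polar_line (R0 * (c a%:Z * c d%:Z)) (u - d%:Z);
                     polar_line (R0 * (c a%:Z * c d%:Z)) (u + d%:Z)]].
Proof.
move=> av hu.
apply/seteqP; split=> x /=.
  case=> -[[]|] /common_diagonalsP[v hv ->] /in_polar_line; rewrite -?mulrA =>
    /(mulfI (lt0r_neq0 R00)).
  - move/(mulfI (lt0r_neq0 ca))/(cosn_eqP R n0) => [h|h].
      rewrite (@polar_line_periodic _ _ n2 _ _ _ _ v (u - b%:Z)) ?inE ?eqxx //.
      by rewrite -dvdz_opp; congr (_ %| _)%Z: h; ring.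
    rewrite (@polar_line_periodic _ _ n2 _ _ _ _ v (u + b%:Z)) ?inE ?eqxx ?orbT
      //.
    by rewrite -dvdz_opp; congr (_ %| _)%Z: h; ring.
  - move/(mulfI (lt0r_neq0 ca))/(cosn_eqP R n0) => [h|h].
      rewrite (@polar_line_periodic _ _ n2 _ _ _ _ v (u - d%:Z)) ?inE ?eqxx
        ?orbT //.
      by rewrite -dvdz_opp; congr (_ %| _)%Z: h; ring.
    rewrite (@polar_line_periodic _ _ n2 _ _ _ _ v (u + d%:Z)) ?inE ?eqxx ?orbT
      //.
    by rewrite -dvdz_opp; congr (_ %| _)%Z: h; ring.
  - by move/av; case; lia.
rewrite !inE => /or4P[] /eqP ->; (split; [|apply/in_polar_line]).
all: try by rewrite mulrA; congr (_ * _);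
  rewrite ?opprD ?opprK addrA subrr add0r ?cosnN.
- by left; left; apply/common_diagonalsP; exists (u - b%:Z) => //; lia.
- by left; left; apply/common_diagonalsP; exists (u + b%:Z) => //; lia.
- by left; right; apply/common_diagonalsP; exists (u - d%:Z) => //; lia.
- by left; right; apply/common_diagonalsP; exists (u + d%:Z) => //; lia.
Qed.

Lemma points_on_line (v : int) (p : R * R) : (2 %| v - b%:Z - d%:Z + 1)%Z ->
  p \in [:: polar_point (R0 * c b%:Z) (v + d%:Z);
            polar_point (R0 * c b%:Z) (v - d%:Z);
            polar_point (R0 * c d%:Z) (v + b%:Z);
            polar_point (R0 * c d%:Z) (v - b%:Z)] ->
  triple_points a b d p /\ polar_line (R0 * (c b%:Z * c d%:Z)) v p.
Proof.
move=> hv.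
rewrite !inE => /or4P[] /eqP ->; (split; [|apply/in_polar_line]).
all: try by rewrite -mulrA ?[c d * _]mulrC; congr (_ * _); congr (_ * _);
  rewrite addrAC subrr add0r ?cosnN.
all: try by rewrite -mulrA; congr (_ * _);
  rewrite addrAC subrr add0r ?cosnN // mulrC.
- by left; right; apply/verticesP; exists (v + d%:Z) => //; lia.
- by left; right; apply/verticesP; exists (v - d%:Z) => //; lia.
- by right; apply/verticesP; exists (v + b%:Z) => //; lia.
- by right; apply/verticesP; exists (v - b%:Z) => //; lia.
Qed.

Lemma points_on (v : int) : no_extra_incidence ->
  (2 %| v - b%:Z - d%:Z + 1)%Z ->
  [set p | triple_points a b d p /\ polar_line (R0 * (c b%:Z * c d%:Z)) v p] =
  [set p | p \in [:: polar_point (R0 * c b%:Z) (v + d%:Z);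
                     polar_point (R0 * c b%:Z) (v - d%:Z);
                     polar_point (R0 * c d%:Z) (v + b%:Z);
                     polar_point (R0 * c d%:Z) (v - b%:Z)]].
Proof.
move=> av hv; apply/seteqP; split=> x /=.
  case=> -[[]|] /verticesP[u hu ->] /in_polar_line; rewrite -?mulrA =>
    /(mulfI (lt0r_neq0 R00)).
  - by move/av; case; lia.
  - move/(mulfI (lt0r_neq0 cb))/(cosn_eqP R n0) => [h|h].
      rewrite (@polar_point_periodic _ _ n2 _ _ _ _ u (v + d%:Z)) ?inE ?eqxx //.
      by congr (_ %| _)%Z: h; ring.
    rewrite (@polar_point_periodic _ _ n2 _ _ _ _ u (v - d%:Z)) ?inE ?eqxx ?orbT
      //.
    by congr (_ %| _)%Z: h; ring.
  - rewrite [c b * _]mulrC => /(mulfI (lt0r_neq0 cd))/(cosn_eqP R n0) =>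
    [[h|h]].
      rewrite (@polar_point_periodic _ _ n2 _ _ _ _ u (v + b%:Z)) ?inE ?eqxx
        ?orbT //.
      by congr (_ %| _)%Z: h; ring.
    rewrite (@polar_point_periodic _ _ n2 _ _ _ _ u (v - b%:Z)) ?inE ?eqxx ?orbT
      //.
    by congr (_ %| _)%Z: h; ring.
exact: points_on_line.
Qed.

Lemma lines_uniq (u : int) :
  uniq [:: polar_line (R0 * (c a%:Z * c b%:Z)) (u - b%:Z);
           polar_line (R0 * (c a%:Z * c b%:Z)) (u + b%:Z);
           polar_line (R0 * (c a%:Z * c d%:Z)) (u - d%:Z);
           polar_line (R0 * (c a%:Z * c d%:Z)) (u + d%:Z)].
Proof.
have p1 : 0 < R0 * (c a%:Z * c b%:Z) by rewrite !mulr_gt0.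
have p2 : 0 < R0 * (c a%:Z * c d%:Z) by rewrite !mulr_gt0.
have ne v w : (polar_line (R0 * (c a%:Z * c b%:Z)) v == polar_line
  (R0 * (c a%:Z * c d%:Z)) w) = false.
  apply/negP => /eqP /(polar_line_inj n2 p1 p2)[] /(mulfI (lt0r_neq0 R00)).
  by move/(mulfI (lt0r_neq0 ca)).
have ne' (e : nat) : (0 < 2 * e < n)%N -> 0 < c e%:Z ->
    (polar_line (R0 * (c a%:Z * c e%:Z)) (u - e%:Z) == polar_line
      (R0 * (c a%:Z * c e%:Z)) (u + e%:Z)) = false.
  move=> he ce; apply/negP => /eqP h.
  have p3 : 0 < R0 * (c a%:Z * c e%:Z) by rewrite !mulr_gt0.
  by have [_ /dvdz_small] := polar_line_inj n2 p3 p3 h; lia.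
by rewrite /= !inE !ne !ne'.
Qed.

Lemma points_uniq (v : int) :
  uniq [:: polar_point (R0 * c b%:Z) (v + d%:Z);
           polar_point (R0 * c b%:Z) (v - d%:Z);
           polar_point (R0 * c d%:Z) (v + b%:Z);
           polar_point (R0 * c d%:Z) (v - b%:Z)].
Proof.
have p1 : 0 < R0 * c b%:Z by rewrite !mulr_gt0.
have p2 : 0 < R0 * c d%:Z by rewrite !mulr_gt0.
have ne u w : (polar_point (R0 * c b%:Z) u == polar_point (R0 * c d%:Z) w) =
  false.
  by apply/negP => /eqP /(polar_point_inj n2 p1 p2)[] /(mulfI (lt0r_neq0 R00)).
have ne' (e f : nat) : (0 < 2 * e < n)%N -> 0 < R0 * c f%:Z ->
    (polar_point (R0 * c f%:Z) (v + e%:Z) == polar_point (R0 * c f%:Z)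
      (v - e%:Z)) = false.
  move=> he ce; apply/negP => /eqP h.
  by have [_ /dvdz_small] := polar_point_inj n2 ce ce h; lia.
by rewrite /= !inE !ne !ne'.
Qed.

Lemma card_lines_through (u : int) : no_extra_incidence ->
  (2 %| u - a%:Z + 1)%Z ->
  [set x | triple_lines a b d x /\ x (polar_point (R0 * c a%:Z) u)] #= `I_4.
Proof. by move=> av hu; rewrite lines_through // (card_uniq_seq (lines_uniq u)).
  Qed.

Lemma card_points_on (v : int) : no_extra_incidence ->
  (2 %| v - b%:Z - d%:Z + 1)%Z ->
  [set p | triple_points a b d p /\ polar_line (R0 * (c b%:Z * c d%:Z)) v p] #=
    `I_4.
Proof. by move=> av hv; rewrite points_on // (card_uniq_seq (points_uniq v)).
  Qed.

(** An extra incidence puts a fifth point on each line of class {b, d}. *)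
Lemma five_points (v s : int) : a <> b -> a <> d ->
  (2 %| v - b%:Z - d%:Z + 1)%Z ->
  (2 %| a%:Z + b%:Z + d%:Z + s)%Z -> c a%:Z * c s = c b%:Z * c d%:Z ->
  ~ ([set p | triple_points a b d p /\ polar_line (R0 * (c b%:Z * c d%:Z)) v p]
    #= `I_4).
Proof.
move=> ab ad hv hs.
have hu : (2 %| v + s - a%:Z + 1)%Z by lia.
have neab : c a%:Z <> c b%:Z by move=> /(cosn_eqP R n0)[] /dvdz_small; lia.
have nead : c a%:Z <> c d%:Z by move=> /(cosn_eqP R n0)[] /dvdz_small; lia.
move=> e h4.
have p0 : 0 < R0 * c a%:Z by rewrite !mulr_gt0.
have p1 : 0 < R0 * c b%:Z by rewrite !mulr_gt0.
have p2 : 0 < R0 * c d%:Z by rewrite !mulr_gt0.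
pose s4 := [:: polar_point (R0 * c b%:Z) (v + d%:Z);
               polar_point (R0 * c b%:Z) (v - d%:Z);
               polar_point (R0 * c d%:Z) (v + b%:Z);
               polar_point (R0 * c d%:Z) (v - b%:Z)].
pose s5 := polar_point (R0 * c a%:Z) (v + s) :: s4.
have u5 : uniq s5.
  rewrite /s5 cons_uniq points_uniq andbT !inE; apply/negP.
  by case/or4P => /eqP /polar_point_inj; move=>
    /(_ n2 p0) []// /(mulfI (lt0r_neq0 R00)).
have : `I_5 #<= `I_4.
  rewrite -(card_le_eqr h4) -(card_le_eql (card_uniq_seq u5)).
  apply: subset_card_le => p /=; rewrite inE => /orP[/eqP ->|].
    split; first by left; left; apply/verticesP; exists (v + s).
    by apply/in_polar_line; rewrite addrAC subrr add0r -mulrA e.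
  exact: points_on_line.
by rewrite card_le_II.
Qed.
End Triple.

Lemma vertices_fin k : vertices k =
  range (fun j : 'I_n => polar_point (R0 * c k%:Z)
    (2 * (j : nat)%:Z + k%:Z - 1)).
Proof.
apply/seteqP; split=> _ [j _ <-]; last by exists (j : nat)%:Z.
have N0 : n%:Z != 0 by lia.
have jn : (`|(j %% n)%Z| < n)%N.
  by have := modz_ge0 j N0; have := ltz_pmod j (_ : 0 < n%:Z); lia.
exists (Ordinal jn) => //; apply: polar_point_periodic => //=.
rewrite gez0_abs ?modz_ge0 // {2}(divz_eq j n); apply/dvdzP;
  exists (- (j %/ n)%Z).
by rewrite PoszM; ring.
Qed.

Lemma common_diagonals_fin a b : common_diagonals a b =
  range (fun j : 'I_n => polar_line (R0 * (c a%:Z * c b%:Z))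
    (2 * (j : nat)%:Z + a%:Z + b%:Z - 1)).
Proof.
apply/seteqP; split=> _ [j _ <-]; last by exists (j : nat)%:Z.
have N0 : n%:Z != 0 by lia.
have jn : (`|(j %% n)%Z| < n)%N.
  by have := modz_ge0 j N0; have := ltz_pmod j (_ : 0 < n%:Z); lia.
exists (Ordinal jn) => //; apply: polar_line_periodic => //=.
rewrite gez0_abs ?modz_ge0 // {2}(divz_eq j n); apply/dvdzP;
  exists (- (j %/ n)%Z).
by rewrite PoszM; ring.
Qed.

Lemma range_ord3 (U : Type) (f : 'I_3 * 'I_n -> U) (f0 f1 f2 : 'I_n -> U) :
  (forall j, f (0, j) = f0 j) -> (forall j, f (1, j) = f1 j) ->
  (forall j, f (2, j) = f2 j) ->
  range f = range f0 `|` range f1 `|` range f2.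
Proof.
move=> e0 e1 e2; apply/seteqP; split=> x.
  case=> -[i j] _ <-; case: i => -[|[|[|//]]] hi.
  - by left; left; exists j => //; rewrite -e0; congr (f (_, _)); apply/val_inj.
  - by left; right; exists j => //; rewrite -e1; congr (f (_, _));
    apply/val_inj.
  - by right; exists j => //; rewrite -e2; congr (f (_, _)); apply/val_inj.
by case=> [[]|] [j _ <-]; [exists (0, j)|exists (1, j)|exists (2, j)].
Qed.

(** Three families of n objects, with n-periodic numbering, that are told apart
    by their distance to the centre. *)
Lemma card_periodic_triple (U : eqType) (F : R -> int -> U) (r : 'I_3 -> R)
  (e : 'I_3 -> int) :
  (forall rho rho' u v, 0 < rho -> 0 < rho' -> F rho u = F rho' v ->
     rho = rho' /\ (2 * n %| u - v)%Z) ->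
  (forall i, 0 < r i) -> injective r ->
  range (fun p : 'I_3 * 'I_n => F (r p.1) (2 * (p.2 : nat)%:Z + e p.1)) #=
    `I_(3 * n).
Proof.
move=> Finj r0 rinj.
have -> : (3 * n = #|{: 'I_3 * 'I_n}|)%N by rewrite card_prod !card_ord.
apply: card_range_fin => -[i j] [i' j'] /=
  /(Finj _ _ _ _ (r0 _) (r0 _))[/rinj <-].
move=> /dvdz_small h; congr (_, _); apply/val_inj => /=.
have := ltn_ord j; have := ltn_ord j'; lia.
Qed.

Section Triple3.
Variables (a b d : nat).
Hypotheses (ab : (0 < a < b)%N) (bd : (b < d)%N) (hd : (2 * d < n)%N).

Let cpos k : (k <= d)%N -> 0 < c k%:Z.
Proof. by move=> kd; apply: cosn_gt0 => //; lia. Qed.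

Let cinj i j : (i <= d)%N -> (j <= d)%N -> c i%:Z = c j%:Z -> i = j.
Proof. by move=> hi hj /(cosn_eqP R n0)[] /dvdz_small; lia. Qed.

Lemma card_triple_points : triple_points a b d #= `I_(3 * n).
Proof.
pose k (i : 'I_3) := nth 0%N [:: a; b; d] i.
have kd i : (k i <= d)%N by case: i => -[|[|[|//]]] ?; rewrite /k /=; lia.
rewrite /triple_points !vertices_fin.
rewrite -(@range_ord3 _ (fun p => polar_point (R0 * c (k p.1)%:Z)
  (2 * (p.2 : nat)%:Z + ((k p.1)%:Z - 1)))).
- apply: (@card_periodic_triple _ polar_point (fun i => R0 * c (k i)%:Z)
  (fun i => (k i)%:Z - 1)).
  + by move=> rho rho' u v h1 h2; exact: (polar_point_inj n2 h1 h2).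
  + by move=> i; rewrite mulr_gt0 ?cpos.
  + move=> i j /(mulfI (lt0r_neq0 R00)) /(cinj (kd _) (kd _)).
    by case: i => -[|[|[|//]]] ?; case: j => -[|[|[|//]]] ?; rewrite /k /= => e;
      apply/val_inj => //=; lia.
- by move=> j; rewrite /= addrA.
- by move=> j; rewrite /= addrA.
- by move=> j; rewrite /= addrA.
Qed.

Lemma card_triple_lines : triple_lines a b d #= `I_(3 * n).
Proof.
pose k (i : 'I_3) := nth (0, 0)%N [:: (a, b); (a, d); (b, d)] i.
have kd i : ((k i).1 <= d)%N && ((k i).2 <= d)%N.
  by case: i => -[|[|[|//]]] ?; rewrite /k /=; lia.
have [a0 b0 d0] : [/\ c a%:Z != 0, c b%:Z != 0 & c d%:Z != 0].
  by split; rewrite lt0r_neq0 // cpos //; lia.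
have n1 : c a%:Z * c b%:Z <> c a%:Z * c d%:Z by move=> /(mulfI a0)/cinj; lia.
have n3 : c a%:Z * c d%:Z <> c b%:Z * c d%:Z by move=> /(mulIf d0)/cinj; lia.
have n4 : c a%:Z * c b%:Z <> c b%:Z * c d%:Z.
  by rewrite mulrC => /(mulfI b0)/cinj; lia.
rewrite /triple_lines !common_diagonals_fin.
rewrite -(@range_ord3 _ (fun p => polar_line
  (R0 * (c (k p.1).1%:Z * c (k p.1).2%:Z))
  (2 * (p.2 : nat)%:Z + ((k p.1).1%:Z + (k p.1).2%:Z - 1)))).
- apply: (@card_periodic_triple _ polar_line
  (fun i => R0 * (c (k i).1%:Z * c (k i).2%:Z))
  (fun i => (k i).1%:Z + (k i).2%:Z - 1)).
  + by move=> rho rho' u v h1 h2; exact: (polar_line_inj n2 h1 h2).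
  + by move=> i; have /andP[h1 h2] := kd i; rewrite !mulr_gt0 ?cpos.
  + move=> i j /(mulfI (lt0r_neq0 R00)).
    case: i => -[|[|[|//]]] ?; case: j => -[|[|[|//]]] ?; rewrite /k /= => e;
    by first [exact: val_inj | case: (n1 e) | case: (n3 e) | case: (n4 e)
      | case: (n1 (esym e)) | case: (n3 (esym e)) | case: (n4 (esym e))].
- by move=> j; rewrite /= !addrA.
- by move=> j; rewrite /= !addrA.
- by move=> j; rewrite /= !addrA.
Qed.
End Triple3.

Let c1 : 0 < c 1. Proof. by apply: (@cosn_gt0 R n n0 1). Qed.
Local Notation polygon k := (fun j : int =>
  polar_point (R0 * c k%:Z) (2 * j + k%:Z - 1)).

(** Here [polygon k] is the k-th n-gon, and [polygon 1] is A itself. *)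
Lemma line_polygon (a b : nat) (j : int) : (0 < b < n)%N -> (2 * a < n)%N ->
  line (polygon a j) (polygon a (j + b%:Z)) =
  polar_line (R0 * (c a%:Z * c b%:Z)) (2 * j + a%:Z + b%:Z - 1).
Proof.
move=> hb ha; have ca : 0 < R0 * c a%:Z by rewrite mulr_gt0 ?cosn_gt0.
rewrite mulrA -(line_polar_points n2 ctr th sg _ ca hb).
by congr (line (polar_point _ _) (polar_point _ _)); ring.
Qed.

Lemma diagonals_polygon (a b : nat) : (0 < b < n)%N -> (2 * a < n)%N ->
  diagonals b (polygon a) = common_diagonals a b.
Proof.
move=> hb ha; rewrite /diagonals /common_diagonals; congr (image _ _);
  apply/funext => j.
exact: line_polygon.
Qed.

Lemma kth_ngon_polygon (k : nat) : (1 < k)%N -> (2 * k < n)%N ->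
  kth_ngon k (polygon 1) = polygon k.
Proof.
move=> k1 kn; apply/funext => j; rewrite /kth_ngon gtn_eqF //.
have hk : (0 < k < n)%N by lia.
rewrite !line_polygon //; try lia.
have -> : 2 * (j - 1) + 1%:Z + k%:Z - 1 = (2 * j + k%:Z - 1) - 1 by ring.
have -> : 2 * j + 1%:Z + k%:Z - 1 = (2 * j + k%:Z - 1) + 1 by ring.
rewrite polar_line_meet // [c 1 * _]mulrC mulrA mulfK ?lt0r_neq0 //.
exact: xget_unique.
Qed.

Variables (l m : nat).
Hypotheses (l1 : (1 < l)%N) (lm : (l < m)%N) (mn : (2 * m < n)%N).
Local Notation P := (K_points l m (polygon 1)).
Local Notation L := (K_lines l m (polygon 1)).

Lemma K_pointsE : P = triple_points 1 l m.
Proof. by rewrite /K_points !kth_ngon_polygon //; lia. Qed.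

(** The l-th diagonals of the m-th n-gon and the m-th diagonals of the l-th
    n-gon are the same lines (Karteszi): both are the class {l, m}. *)
Lemma K_linesE : L = triple_lines 1 l m.
Proof.
rewrite /K_lines !kth_ngon_polygon //; try lia.
rewrite !diagonals_polygon //; try lia.
by rewrite (common_diagonalsC m l) setIid.
Qed.

Lemma triple_points_perm1 a b d : triple_points a b d = triple_points b a d.
Proof. by rewrite /triple_points (setUC (vertices a)). Qed.
Lemma triple_points_perm2 a b d : triple_points a b d = triple_points d a b.
Proof. by rewrite /triple_points setUC setUA. Qed.
Lemma triple_lines_perm1 a b d : triple_lines a b d = triple_lines b a d.
Proof. by rewrite /triple_lines (common_diagonalsC a b) setUAC. Qed.
Lemma triple_lines_perm2 a b d : triple_lines a b d = triple_lines d a b.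
Proof.
rewrite /triple_lines (common_diagonalsC d a) (common_diagonalsC d b) -setUA
  setUC.
by [].
Qed.

Lemma configuration_polygon :
  configuration (3 * n) 4 P L <-> ~ exceptional n l m.
Proof.
have h1 : (0 < 2 * 1 < n)%N by lia.
have hl : (0 < 2 * l < n)%N by lia.
have hm : (0 < 2 * m < n)%N by lia.
rewrite K_pointsE K_linesE; split.
  move=> [_ _ _ H] /(exceptional_relation R)[s [od e]].
  have od' : (2 %| 1%:Z + l%:Z + m%:Z + s%:Z)%Z by lia.
  have five a b d : (0 < 2 * a < n)%N -> (0 < 2 * b < n)%N ->
    (0 < 2 * d < n)%N ->
      b <> d -> a <> b -> a <> d ->
      (2 %| a%:Z + b%:Z + d%:Z + s%:Z)%Z -> c a%:Z * c s%:Z = c b%:Z * c d%:Z ->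
      triple_points 1 l m = triple_points a b d ->
      triple_lines 1 l m = triple_lines a b d -> False.
    move=> ha hb hd bd ab ad o r eP eL; rewrite eP eL in H.
    apply: (@five_points a b d ha hb hd bd (b%:Z + d%:Z - 1) s%:Z ab ad _ o r).
      by lia.
    apply: (H (polar_line (R0 * (c b%:Z * c d%:Z)) (b%:Z + d%:Z - 1))); right.
    by apply/common_diagonalsP; exists (b%:Z + d%:Z - 1) => //; lia.
  have [n1l n1m nlm] : [/\ 1%N <> l, 1%N <> m & l <> m] by split; lia.
  have [nl1 nm1 nml] : [/\ l <> 1%N, m <> 1%N & m <> l] by split; lia.
  case: e => e.
  - exact: (five 1%N l m h1 hl hm nlm n1l n1m od' e).
  - apply: (five l 1%N m hl h1 hm n1m nl1 nlm _ (esym e)).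
    + by lia.
    + exact: triple_points_perm1.
    + exact: triple_lines_perm1.
  - apply: (five m 1%N l hm h1 hl n1l nm1 nml _ (esym e)).
    + by lia.
    + exact: triple_points_perm2.
    + exact: triple_lines_perm2.
move=> nex.
have av s : (2 %| 1%:Z + l%:Z + m%:Z + s)%Z ->
    [/\ c 1 * c s <> c l%:Z * c m%:Z, c l%:Z * c s <> c 1 * c m%:Z &
      c m%:Z * c s <> c 1 * c l%:Z].
  by move=> o; apply: no_relation => //; lia.
have av1 : no_extra_incidence 1 l m by move=> s o; case: (av s o).
have av2 : no_extra_incidence l 1 m by move=> s o; case: (av s _) => //; lia.
have av3 : no_extra_incidence m 1 l by move=> s o; case: (av s _) => //; lia.
split.
- by apply: card_triple_points => //; lia.
- by apply: card_triple_lines => //; lia.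
- move=> p [[]|] /verticesP[u hu ->].
  + by apply: card_lines_through => //; lia.
  + by rewrite triple_lines_perm1; apply: card_lines_through => //; lia.
  + by rewrite triple_lines_perm2; apply: card_lines_through => //; lia.
- move=> x [[]|] /common_diagonalsP[v hv ->].
  + by rewrite triple_points_perm2; apply: card_points_on => //; lia.
  + by rewrite triple_points_perm1; apply: card_points_on => //; lia.
  + by apply: card_points_on => //; lia.
Qed.
End Counting.

Local Close Scope card_scope.
Local Close Scope classical_set_scope.
Local Close Scope ring_scope.
Unset Implicit Arguments.

Theorem theorem6 (R : realType) (n l m : nat) (A : int -> R * R) :
  regular_ngon n A -> (1 < l)%N -> (l < m)%N -> (m <= (n - 1) %/ 2)%N ->
  configuration (3 * n) 4 (K_points l m A) (K_lines l m A) <->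
  ~ exceptional n l m.
Proof.
move=> [n2 [ctr [r [th [sg [r0 HA]]]]]] l1 lm mn.
have n0 : (0 < n)%N by lia.
have c1 : (0 < cosn R n 1)%R by apply: (@cosn_gt0 R n n0 1).
have nR : (n%:R != 0 :> R)%R by rewrite pnatr_eq0 -lt0n.
have -> : A = (fun j : int => polar_point n ctr th sg
    (r / cosn R n 1 * cosn R n 1%:Z) (2 * j + 1%:Z - 1))%R.
  apply/funext => j; rewrite HA /polar_point /ang divfK ?lt0r_neq0 // addrK
    intrM.
  by congr (_ + r * cos (_ + _ * _), _ + r * sin (_ + _ * _))%R; field.
by apply: configuration_polygon; rewrite ?divr_gt0 //; lia.
Qed.
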